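(* In the one-harmonic random graph model of the context, with $\varepsilon_n$, $\omega$, and $k$ held fixed: For every admissible $(b,\varphi,m)$, $h_{b,\varphi,m}(\cdot\mid x)$ is a probability density for every $x\in\mathbb T^d$, and $X_i\sim\mu$, $V_i\sim\mathrm{Unif}(0,1)$. Let $Q\in\mathcal H_k$ and $\tau\in\mathbb T^d$, choose any lift $\widetilde\tau\in\mathbb R^d$ of $\tau$, and define $m_g=Qm$ and $\varphi_g=\varphi+2\pi(Qm)^{\top}\widetilde\tau\pmod{2\pi}$. Then $\varphi_g$ is independent of the chosen lift, and for every $n\ge2$ $$\mathbb P^{(n)}_{b,\varphi,m}=\mathbb P^{(n)}_{b,\varphi_g,m_g}=\mathbb P^{(n)}_{-b,\varphi_g+\pi,m_g}.$$ For every $\varphi'\in\mathbb R/(2\pi\mathbb Z)$, $\mathbb P^{(n)}_{b,\varphi,m}=\mathbb P^{(n)}_{b,\varphi',m}=\mathbb P^{(n)}_{-b,\varphi',m}$; thus the phase, and the sign of a nonzero amplitude $b$, are not identified from the marginal adjacency law. The set $\mathcal H_k$ is a subgroup of $O(d,\mathbb Z)$. With $\mathcal O_k(m)=\{Qm:Q\in\mathcal H_k\}$, the marginal adjacency law is constant over all frequency representatives in $\mathcal O_k(m)$, with the corresponding phase transformation. Since $k$ is even, $-I_d\in\mathcal H_k$, so $\mathcal O_k(m)$ is sign-symmetric. If $b=0$, then $h_{0,\varphi,m}\equiv1$, so every admissible $m\in\mathbb Z^d\setminus\{0\}$ and every $\varphi$ are irrelevant to the latent and adjacency laws. Finally, with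 $$\psi(b,\varphi,m)=\int_0^1\int_{\mathbb T^d}\{h_{b,\varphi,m}(v\mid x)-1\}^2\,\mu(dx)\,dv,$$ one has $\psi(b,\varphi,m)=b^2$; thus $\psi$ is invariant under the transformations above.
   Context: Fix $d\ge1$. $\mathbb T^d=\mathbb R^d/\mathbb Z^d$ with normalized Haar measure $\mu$; $\delta_{\mathbb T^d}(x,y)\in[-1/2,1/2)^d$ is the coordinatewise centered representative of $y-x$. Inner products of torus elements with integer vectors are evaluated with any lift (well defined modulo $\mathbb Z$). Admissible parameters: $m\in\mathbb Z^d\setminus\{0\}$, $\varphi\in\mathbb R/(2\pi\mathbb Z)$, $|b|\le1/\sqrt6$. Put $a(v)=\sqrt3(2v-1)$, $\phi_{m,\varphi}(x)=\sqrt2\cos(2\pi m^{\top}x-\varphi)$, $h_{b,\varphi,m}(v\mid x)=1+b\,a(v)\phi_{m,\varphi}(x)$ for $v\in[0,1]$. $(X_i,V_i)_{i\le n}$ are i.i.d. with joint density $h_{b,\varphi,m}(v\mid x)$ relative to $\mu(dx)\,dv$; $W_i=\omega(V_i)$ with $\omega:[0,1]\to[0,\infty)$ a finite-valued Borel function. Fix $\lambda>0$, $\varepsilon_n>0$, and a finite-valued, nonnegative, even Borel function $k:\mathbb R^d\to[0,\infty)$. Conditional on the latent variables, $A_{ij}$, $i<j$, are independent Bernoulli with $$p_{ij}^{(n)}=1-\exp\Bigl\{-\frac{\lambda}{n\varepsilon_n^d}W_iW_j\,k\Bigl(\frac{\delta_{\mathbb T^d}(X_i,X_j)}{\varepsilon_n}\Bigr)\Bigr\};$$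 $A_{ji}=A_{ij}$, $A_{ii}=0$. $\mathbb P^{(n)}_{b,\varphi,m}$ denotes the unconditional law of the labeled adjacency matrix (for the fixed $\lambda,\varepsilon_n,k,\omega$). $O(d,\mathbb Z)=\{Q\in\mathbb Z^{d\times d}:Q^{\top}Q=I_d\}$ and $\mathcal H_k=\{Q\in O(d,\mathbb Z):k(Qu)=k(u)\text{ for Lebesgue-a.e. }u\in\mathbb R^d\}$. *)

(* Defs.v *)
From HB Require Import structures.
From mathcomp Require Import all_boot all_order all_algebra.
From mathcomp Require Import all_classical all_reals all_analysis.
From mathcomp Require Import ring lra.

Set Implicit Arguments.
Unset Strict Implicit.
Unset Printing Implicit Defensive.

Import Order.TTheory GRing.Theory Num.Theory.
Import numFieldNormedType.Exports.

Local Open Scope classical_set_scope.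
Local Open Scope quotient_scope.
Local Open Scope ring_scope.

(* Reproved because canonical inference does not find the library's
   sigma-finite structure on m1 \x m2. *)
Lemma product_sigma_finite d1 d2 (T1 : measurableType d1)
    (T2 : measurableType d2) (R : realType)
    (m1 : {sigma_finite_measure set T1 -> \bar R})
    (m2 : {sigma_finite_measure set T2 -> \bar R}) :
  sigma_finite setT (m1 \x m2)%E.
Proof.
have /sigma_finiteP[F [TF ndF Foo]] := sigma_finiteT m1.
have /sigma_finiteP[G [TG ndG Goo]] := sigma_finiteT m2.
exists (fun n => F n `*` G n).
  rewrite -setXTT TF TG predeqE => -[x y]; split.
    move=> [/= [n _ Fnx] [k _ Gky]]; exists (maxn n k) => //; split.
    - by move: x Fnx; exact/subsetPset/ndF/leq_maxl.
    - by move: y Gky; exact/subsetPset/ndG/leq_maxr.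
  by move=> [n _ []/= ? ?]; split; exists n.
move=> k; have [? ?] := Foo k; have [? ?] := Goo k.
split; first exact: measurableX.
by rewrite product_measure1E// lte_mul_pinfty// ge0_fin_numE.
Qed.

Lemma pushforward_sigma_additive d1 d2 (T1 : measurableType d1)
    (T2 : measurableType d2) (R : realType) (m : {measure set T1 -> \bar R})
    (f : T1 -> T2) :
  measurable_fun setT f -> semi_sigma_additive (pushforward m f).
Proof.
move=> mf F mF tF mUF; rewrite /pushforward preimage_bigcup.
have mp A : measurable A -> measurable (f @^-1` A).
  by move=> mA; rewrite -[X in measurable X]setTI; exact: mf.
apply: measure_semi_sigma_additive.
- by move=> i; exact: mp.
- apply/trivIsetP => /= i j _ _ ij; rewrite -preimage_setI.
  by move/trivIsetP : tF => /(_ _ _ _ _ ij) ->//; rewrite preimage_set0.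
- by rewrite -preimage_bigcup; exact: mp.
Qed.

Section product_with_tuple.
Context d (T : measurableType d) (R : realType) (n : nat).
Variables (m : {sigma_finite_measure set T -> \bar R}).
Variable mn : {sigma_finite_measure set (n.-tuple T) -> \bar R}.

Definition tuple_cons (p : T * n.-tuple T) : n.+1.-tuple T :=
  [tuple of p.1 :: p.2].

Lemma measurable_tuple_cons : measurable_fun setT tuple_cons.
Proof. by apply: measurable_cons. Qed.

Definition prod_tuple_cons : set (n.+1.-tuple T) -> \bar R :=
  pushforward (m \x mn)%E tuple_cons.

Let prod_tuple_cons0 : prod_tuple_cons set0 = 0%E.
Proof. by rewrite /prod_tuple_cons /pushforward preimage_set0 measure0. Qed.

Let prod_tuple_cons_ge0 A : (0 <= prod_tuple_cons A)%E.
Proof. exact: (measure_ge0 (m \x mn)%E). Qed.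

Let prod_tuple_cons_sigma_additive : semi_sigma_additive prod_tuple_cons.
Proof. exact: (pushforward_sigma_additive measurable_tuple_cons). Qed.

HB.instance Definition _ := isMeasure.Build _ _ _ prod_tuple_cons
  prod_tuple_cons0 prod_tuple_cons_ge0 prod_tuple_cons_sigma_additive.

Let prod_tuple_cons_sigma_finite : sigma_finite setT prod_tuple_cons.
Proof.
have [F TF Foo] := product_sigma_finite m mn.
pose g (t : n.+1.-tuple T) : T * n.-tuple T := (thead t, [tuple of behead t]).
have mg : measurable_fun setT g.
  apply/measurable_fun_pairP; split.
  - exact: measurable_tnth.
  - exact: measurable_behead.
have gK : cancel tuple_cons g.
  by move=> [x t]; rewrite /g/= theadE; congr pair; apply/val_inj.
exists (fun i => g @^-1` F i).
  by rewrite -preimage_bigcup -TF preimage_setT.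
move=> i; have [mF Ffin] := Foo i; split.
  by rewrite -[X in measurable X]setTI; exact: mg.
rewrite /prod_tuple_cons /pushforward -comp_preimage.
by rewrite (_ : g \o tuple_cons = id)//; apply/funext => x /=; rewrite gK.
Qed.

HB.instance Definition _ := Measure_isSigmaFinite.Build _ _ _ prod_tuple_cons
  prod_tuple_cons_sigma_finite.

End product_with_tuple.

Section iterated_product.
Context d (T : measurableType d) (R : realType).
Variables (m : {sigma_finite_measure set T -> \bar R}).

(* The n-th power of m; product_tupleE gives its value on rectangles. *)
Fixpoint product_tuple n : {sigma_finite_measure set (n.-tuple T) -> \bar R} :=
  match n with
  | 0 => \d_([tuple] : 0.-tuple T)
  | k.+1 => prod_tuple_cons m (product_tuple k)
  end.

Lemma product_tupleE n (A : 'I_n -> set T) :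
  (forall i, measurable (A i)) ->
  product_tuple n [set t | forall i, A i (tnth t i)] = (\prod_i m (A i))%E.
Proof.
elim: n A => [|n ih] A mA /=.
  rewrite big_ord0 diracE mem_set//= => i; by case: i.
rewrite big_ord_recl -ih// /prod_tuple_cons /pushforward.
rewrite -product_measure1E//; last first.
  rewrite (_ : [set _ | _] = \bigcap_(i in [set: 'I_n])
      ((@tnth _ T ^~ i) @^-1` A (lift ord0 i))); last first.
    by apply/seteqP; split=> t /= h i; [move=> _|]; exact: (h i).
  apply: fin_bigcap_measurable => // i _; rewrite -[X in measurable X]setTI.
  exact: measurable_tnth.
congr (_ _); apply/seteqP; split=> [[x t]|[x t]] /=.
  move=> h; split; first exact: (h ord0).
  by move=> i; have := h (lift ord0 i); rewrite tnthS.
by move=> [hx h] i; case: (unliftP ord0 i) => [j ->|->]; rewrite ?tnthS.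
Qed.

End iterated_product.

Section Euclidean_space.
Variables (R : realType) (d : nat).

(* The product sigma-algebra, i.e. the Borel sigma-algebra of R^d. *)
Let coords (i : 'I_d) (x : 'cV[R]_d) : R := x i 0.

Let cV_set0 : g_sigma_preimage coords set0.
Proof. exact: sigma_algebra0. Qed.

Let cV_setC A : g_sigma_preimage coords A -> g_sigma_preimage coords (~` A).
Proof. exact: sigma_algebraC. Qed.

Let cV_bigcup (F : _^nat) : (forall i, g_sigma_preimage coords (F i)) ->
  g_sigma_preimage coords (\bigcup_i (F i)).
Proof. exact: sigma_algebra_bigcup. Qed.

HB.instance Definition _ := @isMeasurable.Build default_measure_display
  'cV[R]_d (g_sigma_preimage coords) cV_set0 cV_setC cV_bigcup.

Lemma measurable_coord (i : 'I_d) :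
  measurable_fun setT (fun x : 'cV[R]_d => x i 0).
Proof.
move=> _ Y mY; rewrite setTI; apply: sub_sigma_algebra => /=.
rewrite -bigcup_seq/=; exists i => /=; first by rewrite mem_index_enum.
by exists Y => //; rewrite setTI.
Qed.

Definition col_of_tuple (t : d.-tuple (measurableTypeR R)) : 'cV[R]_d := \col_i tnth t i.

Lemma measurable_col_of_tuple : measurable_fun setT col_of_tuple.
Proof.
move=> _ Y; rewrite setTI; move: Y; apply: smallest_sub => /=.
  split=> [|A|F] /=.
  - by rewrite preimage_set0.
  - by rewrite setTD preimage_setC => /measurableC.
  - by move=> mF; rewrite preimage_bigcup; exact: bigcup_measurable.
rewrite -bigcup_seq/= => A [i _ [B mB <-]]; rewrite setTI.
rewrite (_ : _ @^-1` _ = (@tnth _ (measurableTypeR R) ^~ i) @^-1` B).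
  by rewrite -[X in measurable X]setTI; exact: measurable_tnth.
by apply/seteqP; split=> t /=; rewrite /coords mxE.
Qed.

Definition lebesgue_Rd : set 'cV[R]_d -> \bar R :=
  pushforward (product_tuple (@lebesgue_measure R) d) col_of_tuple.

Let lebesgue_Rd0 : lebesgue_Rd set0 = 0%E.
Proof. by rewrite /lebesgue_Rd /pushforward preimage_set0 measure0. Qed.

Let lebesgue_Rd_ge0 A : (0 <= lebesgue_Rd A)%E.
Proof. exact: (measure_ge0 (product_tuple (@lebesgue_measure R) d)). Qed.

Let lebesgue_Rd_sigma_additive : semi_sigma_additive lebesgue_Rd.
Proof. exact: (pushforward_sigma_additive measurable_col_of_tuple). Qed.


HB.instance Definition _ := isMeasure.Build _ _ _ lebesgue_Rd
  lebesgue_Rd0 lebesgue_Rd_ge0 lebesgue_Rd_sigma_additive.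

Lemma measurable_box (A : 'I_d -> set R) : (forall i, measurable (A i)) ->
  measurable [set x : 'cV[R]_d | forall i, A i (x i 0)].
Proof.
move=> mA; rewrite (_ : [set _ | _] = \bigcap_(i in [set: 'I_d])
    ((fun x : 'cV[R]_d => x i 0) @^-1` A i)); last first.
  by apply/seteqP; split=> x /= h i; [move=> _|]; exact: (h i).
apply: fin_bigcap_measurable => // i _; rewrite -[X in measurable X]setTI.
exact: measurable_coord.
Qed.

Lemma lebesgue_Rd_box (A : 'I_d -> set R) : (forall i, measurable (A i)) ->
  lebesgue_Rd [set x | forall i, A i (x i 0)] =
  (\prod_i lebesgue_measure (A i))%E.
Proof.
move=> mA; rewrite -product_tupleE//; congr (product_tuple _ _ _).
by apply/seteqP; split=> t /= h i; have := h i; rewrite mxE.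
Qed.

Definition unit_cube : set 'cV[R]_d :=
  [set x | forall i, x i 0 \in `[0, 1[].

Lemma measurable_unit_cube : measurable unit_cube.
Proof. exact: (measurable_box (A := fun=> `[0, 1[%classic)). Qed.

Lemma lebesgue_unit_cube : lebesgue_Rd unit_cube = 1%E.
Proof.
rewrite (lebesgue_Rd_box (A := fun=> `[0, 1[%classic))//.
by rewrite big1// => i _; rewrite lebesgue_measure_itv/= lte_fin ltr01 sube0.
Qed.

End Euclidean_space.

Section torus.
Variables (R : realType) (d : nat).

Definition int_lattice : {pred 'cV[R]_d} :=
  fun x => [forall i, x i 0 \is a Num.int].

Let int_lattice_zmod_closed : zmod_closed int_lattice.
Proof.
split=> [|x y /forallP xZ /forallP yZ].
  by apply/forallP => i; rewrite mxE.
by apply/forallP => i; rewrite !mxE rpredB.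
Qed.

HB.instance Definition _ := GRing.isZmodClosed.Build 'cV[R]_d int_lattice
  int_lattice_zmod_closed.

(* R^d / Z^d *)
Definition torus := Quotient.quot int_lattice.

HB.instance Definition _ := EqQuotient.on torus.
HB.instance Definition _ := GRing.Zmodule.on torus.
HB.instance Definition _ := isPointed.Build torus 0.

Definition torus_class (x : 'cV[R]_d) : torus := \pi x.

Lemma torus_classB : {morph torus_class : x y / x - y}.
Proof. by move=> x y; rewrite /torus_class !piE. Qed.

Lemma torus_class_eq (x y : 'cV[R]_d) :
  (torus_class x == torus_class y) = (x - y \in int_lattice).
Proof. by rewrite Quotient.idealrBE. Qed.

Lemma repr_torusK (x : torus) : torus_class (repr x) = x.
Proof. exact: reprK. Qed.

(* The quotient sigma-algebra; since the quotient map is a Borel isomorphism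
   from the unit cube, these are the Borel sets of the torus. *)
Definition torus_measurable : set (set torus) :=
  [set A | measurable (torus_class @^-1` A)].

Let torus_set0 : torus_measurable set0.
Proof. by rewrite /torus_measurable/= preimage_set0. Qed.

Let torus_setC A : torus_measurable A -> torus_measurable (~` A).
Proof. by rewrite /torus_measurable/= preimage_setC; exact: measurableC. Qed.

Let torus_bigcup (F : _^nat) : (forall i, torus_measurable (F i)) ->
  torus_measurable (\bigcup_i (F i)).
Proof.
move=> mF; rewrite /torus_measurable/= preimage_bigcup.
by apply: bigcup_measurable => i _; exact: mF.
Qed.

HB.instance Definition _ := @isMeasurable.Build default_measure_display
  torus torus_measurable torus_set0 torus_setC torus_bigcup.

Lemma measurable_torus_class : measurable_fun setT torus_class.
Proof. by move=> _ A mA; rewrite setTI. Qed.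

(* The image on the torus of Lebesgue measure on the fundamental domain. *)
Definition haar : set torus -> \bar R :=
  pushforward (mrestr (@lebesgue_Rd R d) (@measurable_unit_cube R d))
    torus_class.

Let haar0 : haar set0 = 0%E.
Proof. by rewrite /haar /pushforward preimage_set0 measure0. Qed.

Let haar_ge0 A : (0 <= haar A)%E.
Proof. by rewrite /haar /pushforward measure_ge0. Qed.

Let haar_sigma_additive : semi_sigma_additive haar.
Proof. exact: (pushforward_sigma_additive measurable_torus_class). Qed.

HB.instance Definition _ := isMeasure.Build _ _ _ haar
  haar0 haar_ge0 haar_sigma_additive.

Let haar_setT : haar setT = 1%E.
Proof.
by rewrite /haar /pushforward preimage_setT /mrestr setTI lebesgue_unit_cube.
Qed.

HB.instance Definition _ := Measure_isProbability.Build _ _ _ haar haar_setT.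

End torus.

Section phase.
Variable R : realType.

Definition two_pi_multiples : {pred R} :=
  fun t => t / (2 * pi) \is a Num.int.

Let two_pi_multiples_zmod_closed : zmod_closed two_pi_multiples.
Proof.
split=> [|x y xZ yZ]; rewrite /two_pi_multiples unfold_in ?mul0r//.
by rewrite mulrBl rpredB.
Qed.

HB.instance Definition _ := GRing.isZmodClosed.Build R two_pi_multiples
  two_pi_multiples_zmod_closed.

(* R / 2 pi Z *)
Definition phase := Quotient.quot two_pi_multiples.

HB.instance Definition _ := EqQuotient.on phase.
HB.instance Definition _ := GRing.Zmodule.on phase.

Definition phase_class (t : R) : phase := \pi t.

Lemma phase_class_eq (s t : R) :
  (phase_class s == phase_class t) = (s - t \in two_pi_multiples).
Proof. by rewrite Quotient.idealrBE. Qed.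

Lemma repr_phaseK (p : phase) : phase_class (repr p) = p.
Proof. exact: reprK. Qed.

End phase.

Section torus_functions.
Variables (R : realType) (d : nat).
Implicit Types (m : 'cV[int]_d) (x y : torus R d) (p : phase R).

Definition dotZ m (u : 'cV[R]_d) : R := \sum_i (m i 0)%:~R * u i 0.

Lemma dotZB m : {morph dotZ m : u v / u - v}.
Proof.
move=> u v; rewrite /dotZ -sumrB; apply: eq_bigr => i _.
by rewrite !mxE mulrBr.
Qed.

Lemma dotZ_lattice m u : u \in @int_lattice R d -> dotZ m u \is a Num.int.
Proof.
move=> /forallP uZ; apply: rpred_sum => i _.
by apply: rpredM => //; exact: intr_int.
Qed.

(* repr picks arbitrary lifts of x and p; by harmonicE the value does not
   depend on them. *)
Definition harmonic m p x : R :=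
  Num.sqrt 2 * cos (2 * pi * dotZ m (repr x) - repr p).

Lemma cosD2piZ (t a : R) : a \is a Num.int -> cos (t + 2 * pi * a) = cos t.
Proof.
have cosDn (s : R) n : cos (s + 2 * pi * n%:R) = cos s.
  rewrite mulr_natl mulr_natr; exact: (periodicn (@cosD2pi R)).
move=> /intrP[[n|n] ->]; first exact: cosDn.
by rewrite -[in RHS](subrK (2 * pi * n.+1%:R) t) cosDn NegzE mulrNz mulrN.
Qed.

Lemma harmonicE m (u : 'cV[R]_d) (t : R) :
  harmonic m (phase_class t) (torus_class u) =
  Num.sqrt 2 * cos (2 * pi * dotZ m u - t).
Proof.
have /eqP := repr_torusK (torus_class u).
rewrite torus_class_eq => /(dotZ_lattice m); rewrite dotZB => uZ.
have /eqP := repr_phaseK (phase_class t); rewrite phase_class_eq => tZ.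
rewrite /harmonic; congr (_ * _).
have pi2 : 2 * pi != 0 :> R by rewrite mulf_neq0// gt_eqF// pi_gt0.
rewrite -[RHS](cosD2piZ _ (rpredB uZ tZ)); congr cos.
by rewrite !mulrBr (mulrC _ (_ / _)) divfK//; ring.
Qed.

(* The representative of y - x with coordinates in [-1/2, 1/2[; see
   torus_delta_itv and torus_deltaK. *)
Definition torus_delta x y : 'cV[R]_d :=
  \col_i (repr (y - x) i 0 - (Num.floor (repr (y - x) i 0 + 2^-1))%:~R).

Lemma torus_delta_itv x y i : torus_delta x y i 0 \in `[- 2^-1, 2^-1[.
Proof.
rewrite mxE in_itv/=; set t := (repr (y - x)) i 0.
have := floor_itv (t + 2^-1); rewrite intrD; lra.
Qed.

Lemma torus_deltaK x y : torus_class (torus_delta x y) = y - x.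
Proof.
rewrite -[RHS]repr_torusK; apply/eqP; rewrite torus_class_eq.
apply/forallP => i; rewrite !mxE addrAC subrr sub0r rpredN.
exact: intr_int.
Qed.

End torus_functions.

Section model.
Variables (R : realType) (d : nat).
Implicit Types (m : 'cV[int]_d) (x y : torus R d) (p : phase R).

Definition admissible (b : R) m : Prop :=
  m != 0 /\ `|b| <= (Num.sqrt 6)^-1.

Definition vertex_score (v : R) : R := Num.sqrt 3 * (2 * v - 1).

Definition cond_density (b : R) p m (v : R) x : R :=
  1 + b * vertex_score v * harmonic m p x.

Definition psi (b : R) p m : \bar R :=
  (\int[@lebesgue_measure R]_(v in `[0%R, 1%R])
     \int[@haar R d]_x ((cond_density b p m v x - 1) ^+ 2)%:E)%E.

(* phi + 2 pi m^T u, for u a lift of the translation; m is meant to be the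
   transformed frequency. *)
Definition phase_shift p m (u : 'cV[R]_d) : phase R :=
  p + phase_class (2 * pi * dotZ m u).

Definition latent_ref : set (torus R d * measurableTypeR R) -> \bar R :=
  (@haar R d \x @lebesgue_measure R)%E.

HB.instance Definition _ := Measure.copy latent_ref
  (@haar R d \x @lebesgue_measure R)%E.
HB.instance Definition _ := Measure_isSigmaFinite.Build _ _ _ latent_ref
  (product_sigma_finite (@haar R d) (@lebesgue_measure R)).

Section vertices.
Variable n : nat.
Local Notation latents := (n.-tuple (torus R d * measurableTypeR R)).

Definition position (z : latents) (i : 'I_n) : torus R d := (tnth z i).1.

Definition score (z : latents) (i : 'I_n) : R := (tnth z i).2.

(* (T^d x [0, 1])^n, the scores being typed in R. *)
Definition latent_space : set latents :=
  [set z | forall i, score z i \in `[0, 1]].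

(* The pairs (X_i, V_i) being i.i.d. with density h, their joint law has the
   product density with respect to the n-th power of mu(dx) dv. *)
Definition latent_density (b : R) p m (z : latents) : R :=
  \prod_i cond_density b p m (score z i) (position z i).

Definition latent_law (b : R) p m : set latents -> \bar R := fun S =>
  (\int[product_tuple latent_ref n]_(z in S `&` latent_space)
     (latent_density b p m z)%:E)%E.

Variables (lambda eps : R) (k : 'cV[R]_d -> R) (omega : R -> R).

Definition edge_prob (z : latents) (i j : 'I_n) : R :=
  1 - expR (- (lambda / (n%:R * eps ^+ d) *
    (omega (score z i) * omega (score z j)) *
    k (eps^-1 *: torus_delta (position z i) (position z j)))).

(* Given the latent variables, the entries above the diagonal are independent
   Bernoulli, the matrix is symmetric and its diagonal is zero. *)
Definition adjacency_pmf (z : latents) (a : 'M[bool]_n) : R :=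
  if (a^T == a) && [forall i, ~~ a i i] then
    \prod_(i < n) \prod_(j < n | (i < j)%N)
      bernoulli_pmf (edge_prob z i j) (a i j)
  else 0.

(* 'M[bool]_n is finite, so the law is a function of all sets of matrices. *)
Definition adjacency_law (b : R) p m : set 'M[bool]_n -> \bar R := fun S =>
  (\int[product_tuple latent_ref n]_(z in latent_space)
     (latent_density b p m z * \sum_(a in S) adjacency_pmf z a)%:E)%E.

End vertices.

Definition orthZ : set 'M[int]_d := [set Q | Q^T *m Q = 1%:M].

Definition kernel_sym (k : 'cV[R]_d -> R) : set 'M[int]_d :=
  [set Q | orthZ Q /\
    {ae @lebesgue_Rd R d, forall u, k (map_mx intr Q *m u) = k u}].

Definition kernel_orbit (k : 'cV[R]_d -> R) m : set 'cV[int]_d :=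
  [set Q *m m | Q in kernel_sym k].

End model.

(* Main.v *)
Require Import Defs.
From HB Require Import structures.
From mathcomp Require Import all_boot all_order all_algebra.
From mathcomp Require Import all_classical all_reals all_analysis.
From mathcomp Require Import perm measurable_realfun ring lra.

Set Implicit Arguments.
Unset Strict Implicit.
Unset Printing Implicit Defensive.

Import Order.TTheory GRing.Theory Num.Theory.
Import numFieldNormedType.Exports.

Local Open Scope classical_set_scope.
Local Open Scope ring_scope.

(** The weight of an adjacency matrix given the latent variables depends on the
positions only through the numbers k(delta(X_i, X_j) / eps). For Q in the
stabilizer of k and any u, the map x -> Q x + u of the torus transports the
density with parameters (b, p, m) to the one with parameters
(b, p + 2 pi (Q m)^T u, Q m) ([harmonic_affine]), preserves Haar measure
([haar_affine]), and leaves those numbers unchanged for almost all positions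
([kernel_sym_delta]). Changing variables in every vertex at once
([latent_affine_preserving]) gives the equality of the two adjacency laws
([adjacency_law_affine]). The other symmetries of the adjacency law follow: with
Q = 1, the translations move the phase through the whole circle because m is
nonzero ([phase_shift_surj]), and adding pi to the phase reverses the sign of
the harmonic, which is undone by reversing the sign of b.

Haar invariance and the almost sure statement both come from the structure of
O(d, Z): an orthogonal integer matrix is a signed permutation
([orthZ_signed_perm]), so it maps boxes to boxes, and measures on R^d are
determined by their values on boxes ([measure_box_unique]). Each assertion is
thereby reduced to one coordinate, where it says that Lebesgue measure on a
fundamental domain of R / Z is invariant under translations and the reflection
([lebesgue_fold], [lebesgue_periodic]). The equality of the kernel factors holds
only almost everywhere, both because k is invariant only almost everywhere and
because the centred representative does not commute with a reflection on the
faces of the cube ([torus_delta_act]).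

The integrals of the harmonic come from symmetry: translating by half a period
changes its sign, translating by a quarter period changes the sign of
harmonic^2 - 1, and a function that is odd under a measure-preserving map has
mean zero ([integral_odd]). The marginals of the latent variables are then
Tonelli's theorem on the product space ([latent_law_box]). *)

(** * Measure-preserving maps and products *)

Section measure_preserving.
Context d1 d2 (T1 : measurableType d1) (T2 : measurableType d2).
Variable R : realType.
Variables (m1 : {measure set T1 -> \bar R}) (m2 : {measure set T2 -> \bar R}).

Definition measure_preserving (f : T1 -> T2) :=
  measurable_fun setT f /\
  forall A, measurable A -> m1 (f @^-1` A) = m2 A.

Lemma measure_preserving_integral (f : T1 -> T2) D (g : T2 -> \bar R) :
  measure_preserving f -> measurable D -> measurable_fun D g ->
  (forall y, D y -> (0 <= g y)%E) ->
  (\int[m1]_(x in f @^-1` D) g (f x) = \int[m2]_(y in D) g y)%E.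
Proof.
move=> [mf fE] mD mg g0.
rewrite -[LHS](ge0_integral_pushforward mf)//; last first.
  by move=> y; rewrite inE; exact: g0.
apply: eq_measure_integral => //= A mA _; exact: fE.
Qed.

End measure_preserving.

Section preimage_measurable.
Context d1 d2 (T1 : measurableType d1) (T2 : measurableType d2).

Lemma measurable_preimage (f : T1 -> T2) A :
  measurable_fun setT f -> measurable A -> measurable (f @^-1` A).
Proof. by move=> mf mA; rewrite -[X in measurable X]setTI; exact: mf. Qed.

End preimage_measurable.

Section image_measure.
Context d1 d2 (T1 : measurableType d1) (T2 : measurableType d2).
Variables (R : realType) (m : {measure set T1 -> \bar R}) (f : T1 -> T2).
Variable mf : measurable_fun setT f.

(** The measurability proof is an argument so that the measure structure is
inferred from the term. *)
Definition image_measure (_ : measurable_fun setT f) : set T2 -> \bar R :=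
  pushforward m f.

Let image0 : image_measure mf set0 = 0%E.
Proof. by rewrite /image_measure /pushforward preimage_set0 measure0. Qed.

Let image_ge0 A : (0 <= image_measure mf A)%E.
Proof. exact: measure_ge0. Qed.

Let image_sigma_additive : semi_sigma_additive (image_measure mf).
Proof. exact: pushforward_sigma_additive. Qed.

HB.instance Definition _ := isMeasure.Build _ _ _ (image_measure mf)
  image0 image_ge0 image_sigma_additive.

End image_measure.

Section measure_preserving_prod.
Context (d1 d2 d3 d4 : measure_display)
  (T1 : measurableType d1) (T2 : measurableType d2)
  (T3 : measurableType d3) (T4 : measurableType d4).
Variable R : realType.
Variables (m1 : {sigma_finite_measure set T1 -> \bar R}).
Variables (m2 : {sigma_finite_measure set T2 -> \bar R}).
Variables (m3 : {sigma_finite_measure set T3 -> \bar R}).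
Variables (m4 : {sigma_finite_measure set T4 -> \bar R}).

(** The product measure is the integral of the measures of the sections, so the
preimage may be taken first along the fibres and then along the base. *)
Lemma measure_preserving_prod (f : T1 -> T3) (g : T2 -> T4) :
  measure_preserving m1 m3 f -> measure_preserving m2 m4 g ->
  measure_preserving (m1 \x m2)%E (m3 \x m4)%E (fun p => (f p.1, g p.2)).
Proof.
move=> [mf fE] [mg gE]; split.
  by apply: measurable_fun_pair; exact: measurableT_comp.
move=> A mA /=; rewrite /product_measure1 /=.
transitivity (\int[m1]_(x in f @^-1` setT) m4 (xsection A (f x)))%E.
  rewrite preimage_setT; apply: eq_integral => x _ /=.
  by rewrite -gE; last exact: measurable_xsection.
apply: (measure_preserving_integral (g := fun x => m4 (xsection A x))
  (conj mf fE) measurableT) => //.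
exact: measurable_fun_xsection.
Qed.

End measure_preserving_prod.

Section product_tuple_lemmas.
Context d (T : measurableType d) (R : realType).
Variable m : {sigma_finite_measure set T -> \bar R}.

Lemma measure_preserving_tuple (f : T -> T) n : measure_preserving m m f ->
  measure_preserving (product_tuple m n) (product_tuple m n)
    (fun z => [tuple f (tnth z i) | i < n]).
Proof.
move=> mpf; have [mf _] := mpf.
have mfn k : measurable_fun setT
    (fun z : k.-tuple T => [tuple f (tnth z i) | i < k]).
  apply/measurable_fun_tnthP => i.
  rewrite (_ : _ \o _ = f \o (@tnth k T ^~ i)).
    by apply: measurableT_comp => //; exact: measurable_tnth.
  by apply/funext => z /=; rewrite tnth_mktuple.
split; [exact: mfn|elim: n => [|n ih] A mA /=].
  rewrite (_ : _ @^-1` A = A)//.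
  by apply/seteqP; split=> z /=; rewrite (tuple0 z) (tuple0 (mktuple _)).
rewrite /prod_tuple_cons /pushforward.
have [_ fE] := measure_preserving_prod mpf (conj (mfn n) ih).
rewrite -[RHS]fE; last exact: measurable_preimage (@measurable_tuple_cons _ T n) mA.
congr product_measure1; apply/funext => -[x t]; congr A.
apply: eq_from_tnth => i; rewrite tnth_mktuple.
by case: (unliftP ord0 i) => [j ->|->]; rewrite /= ?tnthS ?tnth0 ?tnth_mktuple.
Qed.

Lemma product_tuple_null1 n (A : set T) (j : 'I_n) : measurable A ->
  m A = 0%E -> product_tuple m n [set z | A (tnth z j)] = 0%E.
Proof.
move=> mA A0.
rewrite (_ : [set _ | _] =
    [set z | forall i, (if i == j then A else setT) (tnth z i)]); last first.
  apply/seteqP; split=> z /=; last by move=> /(_ j); rewrite eqxx.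
  by move=> Az i; case: eqP => [->|].
rewrite (product_tupleE _ (A := fun i => if i == j then A else setT)); last first.
  by move=> i; case: ifP.
by rewrite (bigD1 j)//= eqxx A0 mul0e.
Qed.

(** Tonelli: fix the coordinates up to i; what remains is an event on the single
coordinate j, null by hypothesis. *)
Lemma product_tuple_null2 n (B : set (T * T)) (i j : 'I_n) : measurable B ->
  (forall x, m (xsection B x) = 0%E) -> (i < j)%N ->
  product_tuple m n [set z | B (tnth z i, tnth z j)] = 0%E.
Proof.
move=> mB B0; elim: n i j => [[]//|n ih] i j.
case: (unliftP ord0 j) => [j' ->|->//] ij.
rewrite /= /prod_tuple_cons /pushforward /= /product_measure1.
case: (unliftP ord0 i) ij => [i' ->|-> _].
  rewrite !lift0 ltnS => /ih i'j'; apply: integral0_eq => x _ /=.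
  rewrite -[RHS]i'j'; congr (product_tuple m n _).
  by apply/seteqP; split=> z; rewrite /xsection/= inE/= !tnthS.
apply: integral0_eq => x _ /=.
rewrite -[RHS](@product_tuple_null1 n (xsection B x) j')//; last first.
  exact: measurable_xsection.
congr (product_tuple m n _).
by apply/seteqP; split=> z; rewrite /xsection/= ?inE/= !tnthS ?inE tnth0.
Qed.

Lemma integral_product_tuple n (f : 'I_n -> T -> R) :
  (forall i, measurable_fun setT (f i)) -> (forall i x, 0 <= f i x) ->
  (\int[product_tuple m n]_z (\prod_i f i (tnth z i))%:E =
   \prod_i \int[m]_x (f i x)%:E)%E.
Proof.
elim: n f => [|n ih] f mf f0.
  rewrite big_ord0 (eq_integral (cst 1%E)) => [|z _]; last by rewrite big_ord0.
  by rewrite integral_cst// mul1e /= diracT.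
rewrite big_ord_recl -ih//.
pose g (t : n.-tuple T) : R := \prod_(i < n) f (lift ord0 i) (tnth t i).
have mtnth k (i : 'I_k) (h : T -> R) : measurable_fun setT h ->
    measurable_fun setT (fun z : k.-tuple T => h (tnth z i)).
  by move=> mh; apply: measurableT_comp => //; exact: measurable_tnth.
have mg : measurable_fun setT g.
  by apply: measurable_prod => i _; exact: mtnth.
have g0 t : 0 <= g t by exact: prodr_ge0.
have mF : measurable_fun setT
    (fun z : n.+1.-tuple T => (\prod_i f i (tnth z i))%:E).
  by apply/measurable_EFinP; apply: measurable_prod => i _; exact: mtnth.
have mp : measure_preserving (m \x product_tuple m n)%E
    (product_tuple m n.+1) (@tuple_cons _ T n).
  by split; [exact: measurable_tuple_cons|].
rewrite -(measure_preserving_integral mp measurableT mF); last first.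
  by move=> z _; rewrite lee_fin prodr_ge0.
rewrite preimage_setT.
have prodE p : \prod_i f i (tnth (tuple_cons p) i) = f ord0 p.1 * g p.2.
  rewrite big_ord_recl; congr (_ * _).
  by apply: eq_bigr => i _; rewrite /tuple_cons/= tnthS.
under eq_integral => p _ do rewrite prodE.
rewrite (fubini_tonelli1 (fun p => (f ord0 p.1 * g p.2)%:E))/=; last 2 first.
- apply/measurable_EFinP; apply: measurable_funM; exact: measurableT_comp.
- by move=> p; rewrite lee_fin mulr_ge0.
rewrite /fubini_F /=.
under eq_integral => x _.
  under eq_integral => t _ do rewrite EFinM.
  rewrite ge0_integralZl//; last 3 first.
  - exact/measurable_EFinP.
  - by move=> t _; rewrite lee_fin.
  - by rewrite lee_fin.
  over.
rewrite ge0_integralZr//; first exact/measurable_EFinP.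
- by move=> x _; rewrite lee_fin.
- by apply: integral_ge0 => t _; rewrite lee_fin.
Qed.

End product_tuple_lemmas.

(** * Lebesgue measure on the line, modulo integers *)

Section line.
Variable R : realType.
Local Notation mu := (@lebesgue_measure R).
Implicit Types (A P : set R) (a s t : R).

Lemma measurable_preimageR (f : R -> R) A :
  measurable_fun setT f -> measurable A -> measurable [set r | A (f r)].
Proof. exact: measurable_preimage. Qed.

Lemma lebesgue_translate t A : measurable A -> mu [set r | A (r + t)] = mu A.
Proof.
move=> mA; pose f (r : measurableTypeR R) : measurableTypeR R := r + t.
have mf : measurable_fun setT f by apply: measurable_funD.
rewrite -[LHS]/(pushforward mu f A); apply/esym.
apply: lebesgue_measure_unique => //= _ [[a b]] _ <-.
rewrite /pushforward (_ : f @^-1` _ = `](a - t), (b - t)]%classic); last first.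
  by apply/seteqP; split=> r; rewrite /f/= !in_itv/= ltrBlDr lerBrDr.
rewrite !lebesgue_measure_itv/= !lte_fin ltrD2r.
by case: ifPn => // _; rewrite -!EFinD; congr EFin; ring.
Qed.

Lemma lebesgue_dilate (e : R) A : 0 < e -> measurable A ->
  mu [set r | A (e^-1 * r)] = (e%:E * mu A)%E.
Proof.
move=> e0 mA; pose f (r : measurableTypeR R) : measurableTypeR R := e^-1 * r.
have mf : measurable_fun setT f by apply: measurable_funM.
have ie0 : 0 <= e^-1 by rewrite invr_ge0 ltW.
suff -> : mu A = (e^-1%:E * pushforward mu f A)%E.
  by rewrite muleA -EFinM divff ?gt_eqF// mul1e.
rewrite -[RHS]/(mscale (NngNum ie0) (image_measure mu mf) A).
apply: lebesgue_measure_unique => //= _ [[a b]] _ <-.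
rewrite /mscale/= /image_measure /pushforward.
rewrite (_ : f @^-1` _ = `](e * a), (e * b)]%classic); last first.
  apply/seteqP; split=> r; rewrite /f/= !in_itv/=;
    by rewrite ltr_pdivlMl// ler_pdivrMl.
rewrite !lebesgue_measure_itv/= !lte_fin ltr_pM2l//.
case: ifPn => // _; rewrite ?mule0// -!EFinD -EFinM; congr EFin.
by rewrite -mulrBr mulKf// gt_eqF.
Qed.

Definition frac_part (r : R) : R := r - (Num.floor r)%:~R.

Definition centered (r : R) : R := r - (Num.floor (r + 2^-1))%:~R.

Lemma measurable_floor : measurable_fun setT (fun r : R => (Num.floor r)%:~R : R).
Proof.
apply: nondecreasing_measurable => // r s rs.
by rewrite ler_int le_floor.
Qed.

Lemma measurable_frac_part : measurable_fun setT frac_part.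
Proof. by apply: measurable_funB => //; exact: measurable_floor. Qed.

Lemma measurable_centered : measurable_fun setT centered.
Proof.
apply: measurable_funB => //; apply: measurableT_comp measurable_floor _.
exact: measurable_funD.
Qed.

Lemma frac_partDint r a : a \is a Num.int -> frac_part (r + a) = frac_part r.
Proof.
by move=> aZ; rewrite /frac_part floorDrz// intrD (floorK aZ); ring.
Qed.

Lemma centeredDint r a : a \is a Num.int -> centered (r + a) = centered r.
Proof.
by move=> aZ; rewrite /centered (addrAC r a 2^-1) floorDrz// intrD (floorK aZ); ring.
Qed.

Lemma frac_part_id r : r \in `[0, 1[ -> frac_part r = r.
Proof.
by rewrite in_itv/= => r01; rewrite /frac_part (floor_def (m := 0)) ?subr0.
Qed.

Lemma centered_id r : r \in `[- 2^-1, 2^-1[ -> centered r = r.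
Proof.
rewrite in_itv/= => r01; rewrite /centered (floor_def (m := 0)) ?subr0//.
lra.
Qed.

Lemma frac_part_itv r : frac_part r \in `[0, 1[.
Proof.
rewrite in_itv/= /frac_part; have := floor_itv r; rewrite intrD; lra.
Qed.

Definition periodic1 P := forall r a, a \is a Num.int -> P (r + a) = P r.

(** The fundamental domain [0, 1[ of R / Z may be replaced by any translate: an
integer translation brings a into [0, 1[, and then [1, a + 1[ is moved back to
[0, a[. *)
Lemma lebesgue_periodic P a : periodic1 P -> measurable P ->
  mu (P `&` `[a, a + 1[) = mu (P `&` `[0, 1[).
Proof.
move=> perP mP.
have shift n b c : n \is a Num.int ->
    mu (P `&` `[b, c[) = mu (P `&` `[b + n, c + n[).
  move=> nZ; rewrite -[RHS](lebesgue_translate n)//; last exact: measurableI.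
  congr (mu _); apply/seteqP; split=> r /=; rewrite !in_itv/=;
    by rewrite perP// ltrD2r lerD2r.
rewrite (shift (- (Num.floor a)%:~R)) ?rpredN ?intr_int//.
rewrite addrAC -/(frac_part a).
have := frac_part_itv a; move: (frac_part a) => {}a; rewrite in_itv/= => /andP[a0 a1].
have itvU b c d : b <= c -> c <= d ->
    mu (P `&` `[b, d[) = (mu (P `&` `[b, c[) + mu (P `&` `[c, d[))%E.
  move=> bc cd; rewrite -measureU//.
  - rewrite -setIUr; congr (mu (P `&` _)).
    apply/seteqP; split=> r /=; rewrite !in_itv/=; last by lra.
    by case: (ltP r c) => rc; lra.
  - exact: measurableI.
  - exact: measurableI.
  - by apply/seteqP; split=> r //= [[_ +] [_]]; rewrite !in_itv/=; lra.
rewrite (itvU a 1)//; [|lra..].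
rewrite (itvU 0 a 1)//; [|lra].
rewrite addeC (shift (-1) 1) ?rpredN ?rpred1// subrr addrK.
by [].
Qed.

(** Translations and the reflection of R / Z preserve the measure of the
fundamental domain. *)
Lemma lebesgue_fold s t A : s = 1 \/ s = -1 -> measurable A ->
  mu ([set r | A (frac_part (s * r + t))] `&` `[0, 1[) = mu (A `&` `[0, 1[).
Proof.
move=> s1 mA; pose P := frac_part @^-1` A.
have mP : measurable P by exact: measurable_preimage measurable_frac_part mA.
have perP : periodic1 P by move=> r a aZ; rewrite /P/preimage/= frac_partDint.
transitivity (mu (P `&` `[0, 1[)); last first.
  congr (mu _); apply/seteqP; split=> r [/= Ar r01]; split=> //;
    by move: Ar; rewrite /P/= frac_part_id.
case: s1 => ->.
  rewrite -(lebesgue_periodic t perP)//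
    -(lebesgue_translate t (A := _ `&` _)); last exact: measurableI.
  congr (mu _); apply/seteqP; split=> r /=; rewrite !in_itv/= mul1r;
    by move=> [? rI]; split=> //; move: rI; lra.
rewrite -(lebesgue_periodic (t - 1) perP)//.
(* The reflection moves the excluded endpoint to the other side. *)
rewrite addrNK -(@lebesgue_translate t (P `&` `[t - 1, t[)); last first.
  exact: measurableI.
have mS : measurable [set r : R | A (frac_part (-1 * r + t))].
  apply: (measurable_preimageR (f := fun r => frac_part (-1 * r + t))) => //.
  apply: measurableT_comp measurable_frac_part _.
  by apply: measurable_funD => //; exact: measurable_funM.
have endpoint b : mu ([set r | A (frac_part (-1 * r + t))] `&`
      [set` Interval (BSide b 0) (BSide b 1)]) =
    mu ([set r | A (frac_part (-1 * r + t))] `&` `]0, 1[).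
  set S := [set r | _] in mS *; pose c : R := if b then 0 else 1.
  have cE r : (r \in Interval (BSide b 0) (BSide b 1)) =
      (r \in `]0, 1[) || (r == c).
    rewrite /c; case: b {c}; rewrite !in_itv/=.
      by case: (ltgtP r 0) => [_|_|->]; rewrite ?ltr01 ?orbF.
    by case: (ltgtP r 1) => [_|_|->]; rewrite ?ltr01 ?andbF ?orbF.
  have mSI (i : interval R) : measurable (S `&` [set` i]) by exact: measurableI.
  have mSc : measurable (S `&` [set c]) by exact: measurableI.
  rewrite -[RHS](@measureU0 _ _ _ mu _ (S `&` [set c]));
    [|exact: mSI|exact: mSc|]; last first.
    apply: (@subset_measure0 _ _ _ mu _ [set c]) => //.
    exact: lebesgue_measure_set1.
  congr (mu _); rewrite -setIUr; congr (S `&` _).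
  apply/seteqP; split=> r /=; rewrite cE.
    by move=> /orP[?|/eqP]; [left|right].
  by move=> [->|->]//; rewrite eqxx orbT.
rewrite (endpoint true) -(endpoint false) -lebesgue_measureN; last first.
  exact: measurableI.
congr (mu _); apply/seteqP; split=> r /=; rewrite !in_itv/= mulN1r opprK;
  by move=> [? rI]; split=> //; move: rI; lra.
Qed.

End line.

(** * Boxes and signed permutations *)

Section boxes.
Variables (R : realType) (d : nat).
Local Notation mu := (@lebesgue_measure R).
Local Notation leb := (@lebesgue_Rd R d).
Implicit Types (A : 'I_d -> set R).

Definition box A : set 'cV[R]_d := [set x | forall i, A i (x i 0)].

Definition centered_cube (n : nat) := box (fun=> `[- n%:R, n%:R]%classic).

Lemma boxI A B : box A `&` box B = box (fun i => A i `&` B i).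
Proof.
apply/seteqP; split=> x /=; first by move=> [xA xB] i; split.
by move=> AB; split=> i; have [] := AB i.
Qed.

Lemma measurable_cV d' (T : measurableType d') (f : T -> 'cV[R]_d) :
  (forall i, measurable_fun setT (fun x => f x i 0)) -> measurable_fun setT f.
Proof.
move=> mf _ Y; rewrite setTI; move: Y; apply: smallest_sub => /=.
  split=> [|A|F] /=.
  - by rewrite preimage_set0.
  - by rewrite setTD preimage_setC => /measurableC.
  - by move=> mF; rewrite preimage_bigcup; exact: bigcup_measurable.
rewrite -bigcup_seq/= => A [i _ [B mB <-]]; rewrite setTI.
exact: (measurable_preimage (mf i)).
Qed.

(** Boxes are stable under intersection, generate the Borel sets, and exhaust the
space by cubes of finite measure. *)
Lemma measure_box_unique (m1 m2 : {measure set 'cV[R]_d -> \bar R}) :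
  (forall A, (forall i, measurable (A i)) -> m1 (box A) = m2 (box A)) ->
  (forall n : nat, (m1 (centered_cube n) < +oo)%E) ->
  forall E, measurable E -> m1 E = m2 E.
Proof.
move=> m12 m1oo E mE.
pose G : set (set 'cV[R]_d) := [set box A | A in [set A | forall i, measurable (A i)]].
apply: (@g_sigma_algebra_measure_unique _ R _ G _ centered_cube) => //.
- by move=> _ [A mA <-]; exact: measurable_box.
- by move=> n; exists (fun=> `[- n%:R, n%:R]%classic).
- apply/seteqP; split=> // x _.
  exists (\sum_i (Num.truncn `|x i 0%R|%R).+1)%N => // i /=.
  rewrite in_itv/= -ler_norml.
  apply: le_trans (ltW (truncnS_gt _)) _; rewrite ler_nat.
  by rewrite (bigD1 i)//= leq_addr.
- move=> _ _ [A mA <-] [B mB <-]; rewrite boxI.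
  by exists (fun i => A i `&` B i) => //= i; exact: measurableI.
- by move=> _ [A mA <-]; exact: m12.
- move: E mE; apply: smallest_sub => /=; first exact: smallest_sigma_algebra.
  rewrite -bigcup_seq/= => A [i _ [B mB <-]]; apply: sub_sigma_algebra.
  exists (fun j => if j == i then B else setT) => [j|]; first by case: ifP.
  apply/seteqP; split=> x /=; first by move=> /(_ i); rewrite eqxx.
  by move=> [_ Bx] j; case: eqP => [->|].
Qed.

Lemma lebesgue_centered_cube n : (leb (centered_cube n) < +oo)%E.
Proof.
rewrite lebesgue_Rd_box//.
have [z ->] : exists z : R, mu `[- n%:R, n%:R] = z%:E.
  rewrite lebesgue_measure_itv/=; case: ifPn => _; last by exists 0.
  by exists (n%:R - - n%:R); rewrite EFinB.
by rewrite prodEFin ltry.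
Qed.

Lemma mrestr_box (D : set R) (mD : measurable (box (fun=> D))) A :
  measurable D -> (forall i, measurable (A i)) ->
  mrestr leb mD (box A) = (\prod_i mu (A i `&` D))%E.
Proof.
move=> mD' mA; rewrite /mrestr boxI lebesgue_Rd_box// => i; exact: measurableI.
Qed.

End boxes.

Section signed_permutations.
Variables (R : realType) (d : nat).
Implicit Types (Q : 'M[int]_d).

Lemma orthZ_tr Q : orthZ Q -> Q *m Q^T = 1%:M.
Proof. by move=> QQ; apply: mulmx1C. Qed.

(** A row of integers whose squares sum to 1 has a single nonzero entry. *)
Lemma orthZ_row Q i : orthZ Q ->
  exists2 j, Q i j = 1 \/ Q i j = -1 & forall l, l != j -> Q i l = 0.
Proof.
move=> /orthZ_tr/matrixP/(_ i i); rewrite !mxE eqxx/= => Qi.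
have [j Qj] : exists j, Q i j != 0.
  apply: contrapT => /forallNP Q0; move: Qi.
  rewrite big1// => l _; rewrite mxE.
  by have /negP/negPn/eqP -> := Q0 l; rewrite mul0r.
have sq1 : Q i j ^+ 2 >= 1 by rewrite -gtz0_ge1 lt_neqAle sqr_ge0 eq_sym sqrf_eq0 Qj.
move: Qi; rewrite (bigD1 j)//= mxE -expr2.
have s0 : 0 <= \sum_(l | l != j) Q i l * Q^T l i.
  by apply: sumr_ge0 => l _; rewrite mxE -expr2 sqr_ge0.
move=> s1; have {}sq1 : Q i j ^+ 2 = 1 by lra.
exists j; first by move/eqP: sq1; rewrite sqrf_eq1 => /orP[]/eqP; [left|right].
move=> l lj; have /eqP : \sum_(l | l != j) Q i l * Q^T l i = 0 by apply/eqP; lra.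
rewrite psumr_eq0 => [|h _]; last by rewrite mxE -expr2 sqr_ge0.
move/allP => /(_ l (mem_index_enum _)); rewrite lj mxE -expr2 sqrf_eq0.
by move/eqP.
Qed.

(** Distinct rows cannot have their nonzero entry in the same column, because they
are orthogonal. *)
Lemma orthZ_signed_perm Q : orthZ Q ->
  exists (s : {perm 'I_d}) (e : 'I_d -> R),
    (forall i, e i = 1 \/ e i = -1) /\
    forall (u : 'cV[R]_d) i, (map_mx intr Q *m u) i 0 = e i * u (s i) 0.
Proof.
move=> QO.
have /choice[f fE] : forall i, exists j,
    (Q i j = 1 \/ Q i j = -1) /\ forall l, l != j -> Q i l = 0.
  by move=> i; have [j] := orthZ_row i QO; exists j.
have finj : injective f.
  move=> i i' ff; apply/eqP; apply: contrapT => /negP ii'.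
  have /matrixP/(_ i i') := orthZ_tr QO.
  rewrite !mxE (negbTE ii') (bigD1 (f i))//= big1; last first.
    by move=> l lf; rewrite (fE i).2// mul0r.
  rewrite mxE {2}ff addr0.
  by case: (fE i) (fE i') => -[] -> _ [[] -> _].
exists (perm finj), (fun i => (Q i (f i))%:~R); split.
  by move=> i; have [[] -> _] := fE i; [left|right].
move=> u i; rewrite permE mxE (bigD1 (f i))//= big1 ?addr0 ?mxE//.
by move=> l lf; rewrite mxE (fE i).2// mul0r.
Qed.

End signed_permutations.

(** * Haar measure on the torus *)

Section signed_permutation_invariance.
Variables (R : realType) (d : nat).
Local Notation mu := (@lebesgue_measure R).
Local Notation leb := (@lebesgue_Rd R d).
Local Notation act Q u := (map_mx intr Q *m u : 'cV[R]_d).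
Implicit Types (A : 'I_d -> set R) (Q : 'M[int]_d) (v : 'cV[R]_d).

Lemma measurable_int_action Q : measurable_fun setT (fun u : 'cV[R]_d => act Q u).
Proof.
apply: measurable_cV => i; under eq_fun do rewrite mxE.
apply: measurable_sum => j; apply: measurable_funM => //.
exact: measurable_coord.
Qed.

Lemma measurable_affine Q v i :
  measurable_fun setT (fun u : 'cV[R]_d => (act Q u + v) i 0).
Proof.
under eq_fun do rewrite mxE; apply: measurable_funD => //.
apply: (measurableT_comp (measurable_coord i)); exact: measurable_int_action.
Qed.

(** The preimage of a box under an affine signed permutation followed by a
coordinatewise map is a box whose sides are permuted, so an invariance of
Lebesgue measure on boxes follows from its one-dimensional counterpart. Taken
with f the identity it gives the invariance on R^d, and with f the fractional
part the invariance on the torus. *)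
Lemma lebesgue_coord_image Q v (f : R -> R) (D : set R) A :
  orthZ Q -> measurable_fun setT f -> measurable D ->
  (forall i, measurable (A i)) ->
  (forall e t B, e = 1 \/ e = -1 -> measurable B ->
    mu ([set r | B (f (e * r + t))] `&` D) = mu (B `&` D)) ->
  leb ([set u | forall i, A i (f ((act Q u + v) i 0))] `&` box (fun=> D)) =
  leb (box A `&` box (fun=> D)).
Proof.
move=> /(@orthZ_signed_perm R)[s [e [e1 Qs]]] mf mD mA fP.
pose B j := [set r | A (s^-1 j)%g (f (e (s^-1 j)%g * r + v (s^-1 j)%g 0))].
have mB j : measurable (B j).
  apply: measurable_preimageR (mA _).
  by apply: measurableT_comp => //; apply: measurable_funD.
rewrite (_ : [set u | _] = box B); last first.
  apply/seteqP; split=> u /= Au i; rewrite /B/=.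
    by have := Au (s^-1 i)%g; rewrite mxE Qs permKV.
  by have := Au (s i); rewrite /B/= permK mxE Qs.
rewrite !boxI !lebesgue_Rd_box; last 2 first.
- by move=> i; exact: measurableI.
- by move=> i; exact: measurableI.
rewrite [RHS](reindex_inj (@perm_inj _ s^-1%g)); apply: eq_bigr => j _.
exact: fP.
Qed.

Lemma lebesgue_orthZ Q : orthZ Q -> measure_preserving leb leb (fun u => act Q u).
Proof.
move=> QO; split=> [|E mE]; first exact: measurable_int_action.
pose m := image_measure leb (measurable_int_action Q).
rewrite -[LHS]/(m E); apply/esym; apply: measure_box_unique => //; last first.
  exact: lebesgue_centered_cube.
move=> A mA; rewrite /m /image_measure /pushforward.
have boxT : box (fun=> setT) = setT :> set 'cV[R]_d by apply/seteqP.
rewrite -[LHS](congr1 leb (setIT _)) -[RHS](congr1 leb (setIT _)) -boxT.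
rewrite -(lebesgue_coord_image (f := id) 0 QO)//.
  congr (leb (_ `&` _)); apply/seteqP.
  by split=> u /= Au i; have := Au i; rewrite addr0.
move=> e t B e1 mB; rewrite !setIT.
have mBe : measurable [set r : R | B (r + t)].
  by apply: (measurable_preimageR (f := fun r => r + t)) => //; exact: measurable_funD.
rewrite -[RHS](lebesgue_translate t)//.
case: e1 => ->; first by under eq_set do rewrite mul1r.
by rewrite -[RHS]lebesgue_measureN//; under eq_set do rewrite mulN1r.
Qed.

Definition frac_vec (u : 'cV[R]_d) : 'cV[R]_d := \col_i frac_part (u i 0).

Lemma frac_vecE u i : frac_vec u i 0 = frac_part (u i 0).
Proof. by rewrite mxE. Qed.

Lemma measurable_frac_vec : measurable_fun setT frac_vec.
Proof.
apply: measurable_cV => i; under eq_fun do rewrite mxE.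
exact: (measurableT_comp (@measurable_frac_part R) (@measurable_coord R d i)).
Qed.

Lemma lebesgue_fold_affine Q v E : orthZ Q -> measurable E ->
  leb ([set u | E (frac_vec (act Q u + v))] `&` @unit_cube R d) =
  leb (E `&` @unit_cube R d).
Proof.
move=> QO mE.
have mf : measurable_fun setT (fun u : 'cV[R]_d => frac_vec (act Q u + v)).
  apply: (measurableT_comp measurable_frac_vec).
  by apply: measurable_cV => i; exact: measurable_affine.
pose m1 := image_measure (mrestr leb (@measurable_unit_cube R d)) mf.
pose m2 := mrestr leb (@measurable_unit_cube R d).
rewrite -[LHS]/(m1 E) -[RHS]/(m2 E); apply: measure_box_unique => //.
  move=> A mA; rewrite /m1 /image_measure /pushforward /m2 /mrestr.
  rewrite -[RHS]/(leb (box A `&` box (fun=> `[0, 1[%classic))).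
  rewrite -(@lebesgue_coord_image Q v (@frac_part R) `[0, 1[%classic)//.
  - congr (leb (_ `&` _)); apply/seteqP.
    by split=> u /= Au i; have := Au i; rewrite frac_vecE.
  - exact: measurable_frac_part.
  - by move=> e t B e1 mB; exact: lebesgue_fold.
move=> n; rewrite /m1 /image_measure /pushforward /mrestr.
apply: (@le_lt_trans _ _ (leb (@unit_cube R d))).
  apply: le_measure => //; rewrite ?inE.
    apply: measurableI; last exact: measurable_unit_cube.
    by apply: (measurable_preimage mf); exact: measurable_box.
  exact: measurable_unit_cube.
by rewrite lebesgue_unit_cube ltry.
Qed.

End signed_permutation_invariance.

Section torus_lemmas.
Variables (R : realType) (d : nat).
Local Notation mu := (@lebesgue_measure R).
Local Notation leb := (@lebesgue_Rd R d).
Local Notation T := (torus R d).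
Local Notation act Q u := (map_mx intr Q *m u : 'cV[R]_d).
Implicit Types (Q : 'M[int]_d) (u v : 'cV[R]_d) (x y : T).

(** This is the universal property of the quotient sigma-algebra. *)
Lemma torus_measurable_fun d' (S : measurableType d') (f : T -> S) :
  measurable_fun setT (f \o @torus_class R d) -> measurable_fun setT f.
Proof.
move=> mf _ A mA; rewrite setTI.
exact: (measurable_preimage mf mA).
Qed.

Lemma repr_torus u : exists2 a : 'cV[R]_d, a \in @int_lattice R d &
  repr (torus_class u) = u + a.
Proof.
exists (repr (torus_class u) - u); last by rewrite addrC subrK.
by rewrite -torus_class_eq repr_torusK.
Qed.

(** A measurable section of the quotient map; the representative chosen by the
quotient type need not be measurable. *)
Definition torus_frac x : 'cV[R]_d := frac_vec (repr x).

Lemma torus_fracE u : torus_frac (torus_class u) = frac_vec u.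
Proof.
rewrite /torus_frac; have [a /forallP aZ ->] := repr_torus u.
by apply/matrixP => i j; rewrite !mxE frac_partDint.
Qed.

Lemma torus_class_frac u : torus_class (frac_vec u) = torus_class u.
Proof.
apply/eqP; rewrite torus_class_eq; apply/forallP => i.
by rewrite !mxE /frac_part addrAC subrr sub0r rpredN intr_int.
Qed.

Lemma torus_fracK x : torus_class (torus_frac x) = x.
Proof. by rewrite torus_class_frac repr_torusK. Qed.

Lemma measurable_torus_frac : measurable_fun setT torus_frac.
Proof.
apply: torus_measurable_fun.
rewrite (_ : _ \o _ = @frac_vec R d); first exact: measurable_frac_vec.
by apply/funext => u /=; rewrite torus_fracE.
Qed.

Definition torus_affine Q u x : T := torus_class (act Q (repr x) + u).

Lemma int_lattice_act Q u : u \in @int_lattice R d -> act Q u \in @int_lattice R d.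
Proof.
move=> /forallP uZ; apply/forallP => i; rewrite mxE; apply: rpred_sum => j _.
by rewrite mxE rpredM// intr_int.
Qed.

Lemma torus_affineE Q u v :
  torus_affine Q u (torus_class v) = torus_class (act Q v + u).
Proof.
apply/eqP; rewrite torus_class_eq; have [a aZ ->] := repr_torus v.
by rewrite mulmxDr opprD addrACA subrr addr0 addrAC subrr add0r int_lattice_act.
Qed.

Lemma torus_affineB Q u x y :
  torus_affine Q u y - torus_affine Q u x = torus_affine Q 0 (y - x).
Proof.
rewrite -(repr_torusK x) -(repr_torusK y) -torus_classB !torus_affineE.
by rewrite -torus_classB mulmxBr addr0 opprD addrACA subrr addr0.
Qed.

Lemma haar_affine Q u : orthZ Q ->
  measure_preserving (@haar R d) (@haar R d) (torus_affine Q u).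
Proof.
move=> QO; split=> [|A mA].
  apply: torus_measurable_fun.
  rewrite (_ : _ \o _ = @torus_class R d \o (fun v => act Q v + u)); last first.
    by apply/funext => v /=; rewrite torus_affineE.
  apply: measurableT_comp; first exact: measurable_torus_class.
  by apply: measurable_cV => i; exact: measurable_affine.
rewrite -[RHS]/(leb ((@torus_class R d @^-1` A) `&` @unit_cube R d)).
rewrite -(lebesgue_fold_affine u QO)//.
congr (leb (_ `&` _)); apply/seteqP.
by split=> v /=; rewrite torus_affineE torus_class_frac.
Qed.

(** The sigma-algebra of T * T is a product of quotients and not a quotient, so
measurability is checked on an expression in terms of measurable lifts. *)
Lemma measurable_torusB :
  measurable_fun setT (fun p : T * T => p.2 - p.1).
Proof.
rewrite (_ : (fun _ => _) = @torus_class R d \o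
    (fun p : T * T => torus_frac p.2 - torus_frac p.1)); last first.
  by apply/funext => p /=; rewrite torus_classB !torus_fracK.
apply: measurableT_comp; first exact: measurable_torus_class.
apply: measurable_cV => i; under eq_fun do rewrite mxE [in X in _ + X]mxE.
by apply: measurable_funB; apply: (measurableT_comp (measurable_coord i));
  apply: measurableT_comp => //; exact: measurable_torus_frac.
Qed.

Definition centered_vec u : 'cV[R]_d := \col_i centered (u i 0).

Lemma torus_deltaE x y u : torus_class u = y - x -> torus_delta x y = centered_vec u.
Proof.
move=> uE; apply/matrixP => i j; rewrite /torus_delta -uE !mxE.
by have [a /forallP aZ ->] := repr_torus u; rewrite mxE -/(centered _) centeredDint.
Qed.

Lemma measurable_centered_vec : measurable_fun setT centered_vec.
Proof.
apply: measurable_cV => i; under eq_fun do rewrite mxE.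
exact: (measurableT_comp (@measurable_centered R) (@measurable_coord R d i)).
Qed.

Lemma torus_delta0 x y : torus_delta x y = torus_delta 0 (y - x).
Proof. by rewrite /torus_delta subr0. Qed.

Lemma measurable_torus_delta0 : measurable_fun setT (@torus_delta R d 0).
Proof.
apply: torus_measurable_fun.
rewrite (_ : _ \o _ = centered_vec); first exact: measurable_centered_vec.
by apply/funext => u /=; apply: torus_deltaE; rewrite subr0.
Qed.

Lemma measurable_torus_delta :
  measurable_fun setT (fun p : T * T => torus_delta p.1 p.2).
Proof.
under eq_fun do rewrite torus_delta0.
exact: measurableT_comp measurable_torus_delta0 measurable_torusB.
Qed.

End torus_lemmas.

(** * The stabilizer of the kernel *)

Lemma negligible_exists d (T : measurableType d) (R : realType)
    (m : {measure set T -> \bar R}) (I : countType) (F : I -> set T) :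
  (forall i, m.-negligible (F i)) ->
  m.-negligible [set x | exists i, F i x].
Proof.
move=> mF.
apply: (@negligibleS _ _ _ _
  (\bigcup_n (if unpickle n is Some i then F i else set0))).
  by move=> x [i Fx]; exists (pickle i) => //; rewrite pickleK.
apply: negligible_bigcup => n; case: unpickle => [i|]; first exact: mF.
exact: negligible_set0.
Qed.

Section kernel_stabilizer.
Variables (R : realType) (d : nat) (k : 'cV[R]_d -> R).
Local Notation mu := (@lebesgue_measure R).
Local Notation leb := (@lebesgue_Rd R d).
Local Notation act Q u := (map_mx intr Q *m u : 'cV[R]_d).
Implicit Types (Q : 'M[int]_d) (u v : 'cV[R]_d).

Lemma negligible_orthZ Q (N : set 'cV[R]_d) : orthZ Q -> leb.-negligible N ->
  leb.-negligible [set u | N (act Q u)].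
Proof.
move=> /(@lebesgue_orthZ R)[mQ QE] [B [mB B0 NB]].
exists [set u | B (act Q u)]; split; first exact: (measurable_preimage mQ mB).
  by rewrite -[LHS]/(leb ((fun u => act Q u) @^-1` B)) QE.
by move=> u /NB.
Qed.

Lemma orthZM Q Q' : orthZ Q -> orthZ Q' -> orthZ (Q *m Q').
Proof.
rewrite /orthZ/= => QO Q'O.
by rewrite trmx_mul mulmxA -(mulmxA Q'^T) QO mulmx1.
Qed.

Lemma orthZ_inv Q : orthZ Q -> invmx Q = Q^T.
Proof.
move=> QO; have [_ uQ] := mulmx1_unit QO.
by rewrite -[RHS]mulmx1 -(mulmxV uQ) mulmxA QO mul1mx.
Qed.

Lemma orthZ_trmx Q : orthZ Q -> orthZ Q^T.
Proof. by move=> QO; rewrite /orthZ/= trmxK; exact: orthZ_tr. Qed.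

Lemma kernel_symP Q : kernel_sym k Q <->
  orthZ Q /\ leb.-negligible [set u | k (act Q u) <> k u].
Proof. by []. Qed.

Lemma kernel_sym1 : kernel_sym k 1%:M.
Proof.
apply/kernel_symP; split; first by rewrite /orthZ/= trmx1 mulmx1.
apply: negligibleS (@negligible_set0 _ _ _ leb) => u /=.
by rewrite map_mx1 mul1mx.
Qed.

(** Invariance of k under Q holds off a null set, whose preimage under Q' is again
null because Q' preserves Lebesgue measure. *)
Lemma kernel_symM Q Q' :
  kernel_sym k Q -> kernel_sym k Q' -> kernel_sym k (Q *m Q').
Proof.
move=> /kernel_symP[QO Qk] /kernel_symP[Q'O Q'k]; apply/kernel_symP.
split; first exact: orthZM.
apply: negligibleS (negligibleU (negligible_orthZ Q'O Qk) Q'k) => u /=.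
rewrite map_mxM -mulmxA => QQ'u.
have [Q'u|] := pselect (k (act Q' u) = k u); last by right.
by left; rewrite Q'u.
Qed.

Lemma kernel_symV Q : kernel_sym k Q -> kernel_sym k (invmx Q).
Proof.
move=> /kernel_symP[QO Qk]; rewrite orthZ_inv//; apply/kernel_symP.
split; first exact: orthZ_trmx.
apply: negligibleS (negligible_orthZ (orthZ_trmx QO) Qk) => u /=.
by rewrite mulmxA -map_mxM orthZ_tr// map_mx1 mul1mx => /nesym.
Qed.

Lemma kernel_symN1 : (forall u, k (- u) = k u) -> kernel_sym k (- 1%:M).
Proof.
move=> kN; apply/kernel_symP; split.
  have -> : - 1%:M = (-1)%:M :> 'M[int]_d by rewrite raddfN.
  by rewrite /orthZ/= tr_scalar_mx -scalar_mxM mulrNN mulr1.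
apply: negligibleS (@negligible_set0 _ _ _ leb) => u /=.
by rewrite map_mxN map_mx1 mulNmx mul1mx kN.
Qed.

(** Under Haar measure the centred representative, dilated by 1 / eps, is
distributed as eps^d times Lebesgue measure on a cube. *)
Lemma haar_centered_null (eps : R) (N : set 'cV[R]_d) : 0 < eps ->
  measurable N -> leb N = 0%E ->
  @haar R d [set w | N (eps^-1 *: torus_delta 0 w)] = 0%E.
Proof.
move=> e0 mN N0.
pose D : set R := `[- 2^-1 * eps^-1, 2^-1 * eps^-1[%classic.
have mD : measurable (box (d := d) (fun=> D)).
  by apply: measurable_box => _; exact: measurable_itv.
have mf : measurable_fun setT (fun u => eps^-1 *: centered_vec u : 'cV[R]_d).
  apply: measurable_cV => i; under eq_fun do rewrite mxE.
  apply: measurable_funM => //.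
  exact: (measurableT_comp (measurable_coord i) (@measurable_centered_vec R d)).
have ed0 : 0 <= eps ^+ d by rewrite exprn_ge0// ltW.
pose m1 := image_measure (mrestr leb (@measurable_unit_cube R d)) mf.
pose m2 := mscale (NngNum ed0) (mrestr leb mD).
have m2N : m2 N = 0%E.
  rewrite /m2 /mscale/= /mrestr [X in (_ * X)%E](_ : _ = 0%E) ?mule0//.
  by apply: (@subset_measure0 _ _ _ leb _ N) => //; exact: measurableI.
rewrite -m2N -[RHS](@measure_box_unique _ _ m1)//.
- rewrite -[LHS]/(mrestr leb (@measurable_unit_cube R d)
    [set u | N (eps^-1 *: torus_delta 0 (torus_class u))]).
  rewrite /m1 /image_measure /pushforward; congr mrestr.
  apply/seteqP; split=> u /=; rewrite (@torus_deltaE _ _ _ _ u) ?subr0//.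
- move=> A mA; rewrite /m1 /m2 /image_measure /pushforward.
  rewrite -[RHS]/((eps ^+ d)%:E * mrestr leb mD (box A))%E mrestr_box//;
    last exact: measurable_itv.
  rewrite -[LHS]/(leb ([set u | box A (eps^-1 *: centered_vec u)] `&`
    @unit_cube R d)).
  rewrite (_ : _ `&` _ = box (fun i =>
      [set r | A i (eps^-1 * centered r)] `&` `[0, 1[%classic)); last first.
    apply/seteqP; split=> u /=.
      by move=> [uA u01] i; split; [have := uA i; rewrite !mxE|exact: u01].
    by move=> uA; split=> i; have [] := uA i; rewrite ?mxE.
  have mAc i : measurable [set r | A i (eps^-1 * centered r)].
    apply: measurable_preimageR (mA i).
    by apply: measurable_funM => //; exact: measurable_centered.
  rewrite lebesgue_Rd_box => [|i]; last exact: measurableI.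
  transitivity (\prod_(i < d) (eps%:E * mu (A i `&` D)))%E; last first.
    rewrite big_split/= prodEFin prodr_const card_ord//.
  apply: eq_bigr => i _.
  rewrite -(@lebesgue_periodic _ _ (- 2^-1))//; last first.
    by move=> r a aZ; rewrite /= (centeredDint r aZ).
  transitivity (mu [set r | (A i `&` D) (eps^-1 * r)]); last first.
    by rewrite lebesgue_dilate//; apply: measurableI => //; exact: measurable_itv.
  have DE r : D (eps^-1 * r) = (r \in `[- 2^-1, 2^-1[) :> Prop.
    rewrite /D/= !in_itv/= [eps^-1 * r]mulrC.
    by rewrite ler_pM2r ?invr_gt0// ltr_pM2r ?invr_gt0.
  congr (mu _); apply/seteqP; rewrite (_ : - 2^-1 + 1 = 2^-1); last by lra.
  split=> r /=; rewrite DE => -[Ar rI]; split=> //.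
    by move: Ar; rewrite centered_id.
  by rewrite centered_id.
- move=> n; rewrite /m1 /image_measure /pushforward /mrestr.
  apply: (@le_lt_trans _ _ (leb (@unit_cube R d))).
    apply: le_measure => //; rewrite ?inE.
      apply: measurableI; last exact: measurable_unit_cube.
      by apply: (measurable_preimage mf); exact: measurable_box.
    exact: measurable_unit_cube.
  by rewrite lebesgue_unit_cube ltry.
Qed.

(** A signed permutation preserves the cube ]-1/2, 1/2[^d; a face at -1/2 would be
sent to 1/2, whose centred representative is -1/2. *)
Lemma torus_delta_act Q w : orthZ Q ->
  (forall i, torus_delta (0 : torus R d) w i 0 != - 2^-1) ->
  torus_delta 0 (torus_affine Q 0 w) = act Q (torus_delta 0 w).
Proof.
move=> QO wP; set c := torus_delta 0 w.
have cw : torus_class c = w by rewrite torus_deltaK subr0.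
rewrite -{1}cw torus_affineE (@torus_deltaE _ _ _ _ (act Q c)); last first.
  by rewrite subr0 addr0.
have [s [e [e1 Qs]]] := orthZ_signed_perm R QO.
apply/matrixP => i j; rewrite (ord1 j) mxE !Qs centered_id//.
have := torus_delta_itv 0 w (s i); rewrite -/c !in_itv/= => /andP[c1 c2].
have := wP (s i); rewrite -/c => c3.
have {c1 c3}c1' : - 2^-1 < c (s i) 0 by rewrite lt_neqAle eq_sym c3.
by case: (e1 i) => ->; lra.
Qed.

(** The exceptional set is the null set of u with k(Q u) <> k(u), together with
the faces of the cube where the centred representative fails to commute with Q. *)
Lemma kernel_sym_haar (eps : R) Q : 0 < eps -> kernel_sym k Q ->
  (@haar R d).-negligible [set w |
    k (eps^-1 *: torus_delta 0 (torus_affine Q 0 w)) <>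
    k (eps^-1 *: torus_delta 0 w)].
Proof.
move=> e0 /kernel_symP[QO [N [mN N0 QN]]].
pose F (i : 'I_d) := [set u : 'cV[R]_d | u i 0 = - 2^-1 * eps^-1].
have [M [mM M0 FM]] : leb.-negligible [set u | exists i, F i u].
  apply: negligible_exists => i.
  pose A (j : 'I_d) : set R := if j == i then [set (- 2^-1 * eps^-1)] else setT.
  have mA j : measurable (A j) by rewrite /A; case: ifP.
  exists (box A); split; first exact: measurable_box.
    transitivity (\prod_j mu (A j))%E; first exact: lebesgue_Rd_box.
    by rewrite (bigD1 i)//= {1}/A eqxx lebesgue_measure_set1 mul0e.
  by move=> u /= ui j; rewrite /A; case: eqP => [->|].
exists [set w | (N `|` M) (eps^-1 *: torus_delta 0 w)]; split.
- apply: (@measurable_preimage _ _ _ _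
    (fun w : torus R d => eps^-1 *: torus_delta 0 w)); last exact: measurableU.
  apply: measurable_cV => i; under eq_fun do rewrite mxE.
  apply: measurable_funM => //.
  exact: (measurableT_comp (measurable_coord i) (@measurable_torus_delta0 R d)).
- apply: haar_centered_null => //; first exact: measurableU.
  exact: etrans (measureU0 mN mM M0) N0.
- move=> w /= kw.
  have [[i wi]|wP] := pselect (exists i, torus_delta (0 : torus R d) w i 0 = - 2^-1).
    by right; apply: FM; exists i; rewrite /F/= mxE wi mulrC.
  left; apply: QN => /=; rewrite -scalemxAr -torus_delta_act//.
  by move=> i; apply/eqP => wi; apply: wP; exists i.
Qed.

(** The difference of the images of x and y is the image of y - x under Q alone,
and y - x is Haar distributed when y is. *)
Lemma kernel_sym_delta (eps : R) Q u (x : torus R d) : 0 < eps -> kernel_sym k Q ->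
  (@haar R d).-negligible [set y |
    k (eps^-1 *: torus_delta (torus_affine Q u x) (torus_affine Q u y)) <>
    k (eps^-1 *: torus_delta x y)].
Proof.
move=> e0 kQ; have [N [mN N0 QN]] := kernel_sym_haar e0 kQ.
(* The translation y |-> y - x. *)
have O1 : @orthZ d 1%:M by rewrite /orthZ/= trmx1 mulmx1.
have [mT TE] := @haar_affine R d 1%:M (- repr x) O1.
exists (torus_affine 1%:M (- repr x) @^-1` N); split.
- exact: (measurable_preimage mT mN).
- exact: etrans (TE _ mN) N0.
- move=> y /=; rewrite torus_delta0 torus_affineB (torus_delta0 x y) => ky.
  apply: QN => /=; rewrite (_ : torus_affine _ _ y = y - x)//.
  by rewrite /torus_affine map_mx1 mul1mx torus_classB !repr_torusK.
Qed.

End kernel_stabilizer.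

(** * Harmonics and conditional densities *)

(** The integrals of 1 + f and 1 - f agree by the symmetry and add up to 2. The
bound on f keeps both integrands nonnegative. *)
Lemma integral_odd (R : realType) d' (S : measurableType d')
    (mu : {measure set S -> \bar R})
    (D : set S) (g : S -> S) (f : S -> R) :
  measurable D -> mu D = 1%E -> measure_preserving mu mu g -> g @^-1` D = D ->
  measurable_fun D f -> (forall x, D x -> `|f x| <= 1) ->
  (forall x, D x -> f (g x) = - f x) ->
  (\int[mu]_(x in D) (1 + f x)%:E = 1)%E.
Proof.
move=> mD D1 mg gD mf f1 fg.
have f0 x : D x -> 0 <= 1 + f x by move=> /f1; rewrite ler_norml; lra.
have f0' x : D x -> 0 <= 1 - f x by move=> /f1; rewrite ler_norml; lra.
have mf1 : measurable_fun D (fun x => (1 + f x)%:E).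
  by apply/measurable_EFinP; apply: measurable_funD.
have mf1' : measurable_fun D (fun x => (1 - f x)%:E).
  by apply/measurable_EFinP; apply: measurable_funB.
have IE : (\int[mu]_(x in D) (1 + f x)%:E = \int[mu]_(x in D) (1 - f x)%:E)%E.
  rewrite -(measure_preserving_integral mg mD mf1).
    by rewrite gD; apply: eq_integral => x; rewrite inE => Dx; rewrite fg.
  by move=> y Dy; rewrite lee_fin f0.
have : (\int[mu]_(x in D) (1 + f x)%:E + \int[mu]_(x in D) (1 - f x)%:E = 2%:E)%E.
  rewrite -ge0_integralD//.
  rewrite (eq_integral (cst 2%:E)) => [|x _].
    by rewrite integral_cst//= D1 mule1.
  by rewrite /= -EFinD; congr EFin; ring.
rewrite -IE; have : (0 <= \int[mu]_(x in D) (1 + f x)%:E)%E.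
  by apply: integral_ge0 => x Dx; rewrite lee_fin f0.
case: (\int[mu]_(x in D) (1 + f x)%:E)%E => [r| |]//= _ [r2].
by congr EFin; lra.
Qed.

Local Notation harmonic := Defs.harmonic.

Section harmonic_lemmas.
Variables (R : realType) (d : nat).
Local Notation T := (torus R d).
Local Notation act Q u := (map_mx intr Q *m u : 'cV[R]_d).
Implicit Types (Q : 'M[int]_d) (m : 'cV[int]_d) (u v : 'cV[R]_d).
Implicit Types (p : phase R) (x : T) (b s t : R).

Lemma phase_classD : {morph (@phase_class R) : s t / s + t}.
Proof. by move=> s t; rewrite /phase_class !piE. Qed.

Lemma dotZ_mx m u : dotZ m u = ((map_mx intr m)^T *m u) 0 0.
Proof. by rewrite mxE; apply: eq_bigr => i _; rewrite !mxE. Qed.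

Lemma dotZD m : {morph @dotZ R d m : u v / u + v}.
Proof. by move=> u v; rewrite !dotZ_mx mulmxDr mxE. Qed.

Lemma dotZ_act Q m v : orthZ Q -> dotZ (Q *m m) (act Q v) = dotZ m v.
Proof.
move=> QO; rewrite !dotZ_mx map_mxM trmx_mul -mulmxA (mulmxA _ (map_mx _ Q)).
by rewrite (map_trmx _ Q) -(map_mxM _ Q^T Q) QO map_mx1 mul1mx.
Qed.

(** The phase shift 2 pi (Q m)^T u cancels the translation, and
(Q m)^T (Q v) = m^T v. *)
Lemma harmonic_affine Q m p u x : orthZ Q ->
  harmonic (Q *m m) (phase_shift p (Q *m m) u) (torus_affine Q u x) =
  harmonic m p x.
Proof.
move=> QO; rewrite -(repr_torusK x) -(repr_phaseK p) torus_affineE.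
rewrite /phase_shift -phase_classD !harmonicE dotZD dotZ_act//.
by congr (_ * cos _); ring.
Qed.

Lemma harmonic_translate m t v u :
  harmonic m (phase_class t) (torus_affine 1%:M u (torus_class v)) =
  Num.sqrt 2 * cos (2 * pi * dotZ m v - t + 2 * pi * dotZ m u).
Proof.
rewrite torus_affineE map_mx1 mul1mx harmonicE dotZD.
by congr (_ * cos _); ring.
Qed.

Lemma harmonic_pi m p x : harmonic m (p + phase_class pi) x = - harmonic m p x.
Proof.
rewrite -(repr_torusK x) -(repr_phaseK p) -phase_classD !harmonicE.
rewrite -mulrN; congr (_ * _).
by rewrite -[RHS]cosDpi -(cosD2pi (_ - (_ + _))); congr cos; ring.
Qed.

Lemma dotZ_surj m s : m != 0 -> exists u, dotZ m u = s.
Proof.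
move=> m0; have [i mi] : exists i, m i 0 != 0.
  apply: contrapT => /forallNP mP; move/negP: m0; apply; apply/eqP/matrixP => i j.
  by rewrite (ord1 j) mxE; have /negP/negPn/eqP := mP i.
exists (\col_j (if j == i then s / (m i 0)%:~R else 0)).
rewrite /dotZ (bigD1 i)//= big1 => [|j ji]; last first.
  by rewrite mxE (negbTE ji) mulr0.
by rewrite addr0 mxE eqxx mulrC divfK// intr_eq0.
Qed.

Lemma phase_shift_lift p m u u' : torus_class u = torus_class u' ->
  phase_shift p m u = phase_shift p m u'.
Proof.
move=> /eqP; rewrite torus_class_eq => /(dotZ_lattice m); rewrite dotZB => uZ.
congr (p + _); apply/eqP; rewrite phase_class_eq.
rewrite -mulrBr unfold_in /two_pi_multiples mulrC mulKf//.
by rewrite mulf_neq0// gt_eqF// pi_gt0.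
Qed.

Lemma phase_shift_surj p p' m : m != 0 -> exists u, phase_shift p m u = p'.
Proof.
move=> m0; have pi2 : 2 * pi != 0 :> R by rewrite mulf_neq0// gt_eqF// pi_gt0.
have [u mu] := dotZ_surj ((repr p' - repr p) / (2 * pi)) m0.
exists u; rewrite /phase_shift mu mulrC divfK//.
by rewrite -[p in p + _]repr_phaseK -phase_classD addrC subrK repr_phaseK.
Qed.

Lemma measurable_harmonic m p : measurable_fun setT (@Defs.harmonic R d m p).
Proof.
apply: torus_measurable_fun; rewrite -(repr_phaseK p).
rewrite (_ : _ \o _ = fun u : 'cV[R]_d =>
    Num.sqrt 2 * cos (2 * pi * dotZ m u - repr p)); last first.
  by apply/funext => u /=; rewrite harmonicE.
apply: measurable_funM => //.
have mc : measurable_fun setT (@cos R).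
  by apply: continuous_measurable_fun => ?; exact: continuous_cos.
apply: (measurableT_comp mc); apply: measurable_funB => //.
apply: measurable_funM => //; apply: measurable_sum => i.
by apply: measurable_funM => //; exact: measurable_coord.
Qed.

Lemma harmonic_bound m p x : `|harmonic m p x| <= Num.sqrt 2.
Proof.
rewrite normrM ger0_norm ?sqrtr_ge0// ler_piMr ?sqrtr_ge0//.
by rewrite ler_norml cos_geN1 cos_le1.
Qed.

(** This is where the bound on b comes from: sqrt 6 = sqrt 3 * sqrt 2. *)
Lemma score_sqrt2_bound b m (v : R) : admissible b m -> v \in `[0, 1] ->
  `|b * vertex_score v| * Num.sqrt 2 <= 1.
Proof.
move=> [_ b6]; rewrite in_itv/= => v01.
have a3 : `|vertex_score v| <= Num.sqrt 3.
  rewrite normrM ger0_norm ?sqrtr_ge0// ler_piMr ?sqrtr_ge0//.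
  by rewrite ler_norml; lra.
have E : 1 = (Num.sqrt 6)^-1 * Num.sqrt 3 * Num.sqrt 2 :> R.
  by rewrite -mulrA -sqrtrM// -natrM mulVf// gt_eqF// sqrtr_gt0.
rewrite [leRHS]E (normrM b); apply: ler_wpM2r; first exact: sqrtr_ge0.
exact: ler_pM.
Qed.

Lemma score_bound b m p (v : R) x : admissible b m -> v \in `[0, 1] ->
  `|b * vertex_score v * harmonic m p x| <= 1.
Proof.
move=> bm v01; apply: le_trans (score_sqrt2_bound bm v01).
rewrite normrM; apply: ler_wpM2l => //; exact: harmonic_bound.
Qed.

Lemma cond_density_ge0 b p m (v : R) x : admissible b m -> v \in `[0, 1] ->
  0 <= cond_density b p m v x.
Proof.
move=> /(score_bound p x) + v01 => /(_ _ v01); rewrite ler_norml /cond_density.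
by lra.
Qed.

Lemma cond_density_opp b p m (v : R) x :
  cond_density (- b) (p + phase_class pi) m v x = cond_density b p m v x.
Proof. by rewrite /cond_density harmonic_pi; ring. Qed.

Lemma measurable_vertex_score D : measurable_fun D (@vertex_score R).
Proof.
by apply: measurable_funM => //; apply: measurable_funB.
Qed.

Lemma measurable_cond_density b p m :
  measurable_fun setT (fun q : T * measurableTypeR R => cond_density b p m q.2 q.1).
Proof.
apply: measurable_funD => //; apply: measurable_funM.
  apply: measurable_funM => //.
  exact: (measurableT_comp (@measurable_vertex_score setT)).
exact: (measurableT_comp (measurable_harmonic m p)).
Qed.

Lemma integral_harmonic_density m p (c : R) : m != 0 -> `|c| * Num.sqrt 2 <= 1 ->
  (\int[@haar R d]_x (1 + c * harmonic m p x)%:E = 1)%E.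
Proof.
(* Half a period: m^T u = 1/2 adds pi to the angle. *)
move=> m0 c1; have [u um] := dotZ_surj (2^-1) m0.
have O1 : @orthZ d 1%:M by rewrite /orthZ/= trmx1 mulmx1.
apply: (@integral_odd _ _ _ (@haar R d) setT (torus_affine 1%:M u)) => //.
- exact: probability_setT.
- exact: haar_affine.
- by apply: measurable_funM => //; exact: measurable_harmonic.
- move=> x _; rewrite normrM; apply: le_trans c1.
  by rewrite ler_wpM2l// harmonic_bound.
- move=> x _; rewrite -(repr_torusK x) -(repr_phaseK p) harmonic_translate.
  rewrite um harmonicE -mulrN; congr (_ * _); rewrite -mulrN; congr (_ * _).
  by rewrite -cosDpi; congr cos; field.
Qed.

Lemma integral_harmonic_sq m p : m != 0 ->
  (\int[@haar R d]_x (harmonic m p x ^+ 2)%:E = 1)%E.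
Proof.
(* A quarter of a period turns 2 cos^2 into 2 sin^2 = 2 - 2 cos^2. *)
move=> m0; have [u um] := dotZ_surj (4^-1) m0.
have O1 : @orthZ d 1%:M by rewrite /orthZ/= trmx1 mulmx1.
have sq2 : Num.sqrt 2 ^+ 2 = 2 :> R by rewrite sqr_sqrtr.
rewrite (eq_integral (fun x => (1 + (harmonic m p x ^+ 2 - 1))%:E)); last first.
  by move=> x _; rewrite addrC subrK.
apply: (@integral_odd _ _ _ (@haar R d) setT (torus_affine 1%:M u)) => //.
- exact: probability_setT.
- exact: haar_affine.
- apply: measurable_funB => //; apply: measurable_funX.
  exact: measurable_harmonic.
- move=> x _; have : harmonic m p x ^+ 2 <= 2.
    by rewrite -sq2 -real_normK ?num_real// lerXn2r ?nnegrE// ?sqrtr_ge0// harmonic_bound.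
  by have := sqr_ge0 (harmonic m p x); rewrite ler_norml; lra.
- move=> x _; rewrite -(repr_torusK x) -(repr_phaseK p) harmonic_translate.
  rewrite um harmonicE (_ : 2 * pi * 4^-1 = pi / 2); last by field.
  rewrite cosDpihalf !exprMn sq2 sqrrN.
  have := cos2Dsin2 (2 * pi * dotZ m (repr x) - repr p).
  by lra.
Qed.

End harmonic_lemmas.

(** * Integrals over the scores *)

Section score_integrals.
Variable R : realType.
Local Notation mu := (@lebesgue_measure R).

Lemma lebesgue_reflect : measure_preserving mu mu (fun v : measurableTypeR R => 1 - v).
Proof.
split; first exact: measurable_funB.
move=> A mA; rewrite -[RHS](lebesgue_translate 1)//.
rewrite -[RHS]lebesgue_measureN; last first.
  by apply: (measurable_preimageR (f := fun r => r + 1)) => //; exact: measurable_funD.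
by congr (mu _); apply/seteqP; split=> v /=; rewrite addrC.
Qed.

Lemma lebesgue_unit : mu `[0, 1] = 1%E.
Proof. by rewrite lebesgue_measure_itv/= lte_fin ltr01 sube0. Qed.

Lemma integral_score_density (c : R) :
  (forall v, v \in `[0, 1] -> `|c * vertex_score v| <= 1) ->
  (\int[mu]_(v in `[0%R, 1%R]) (1 + c * vertex_score v)%:E = 1)%E.
Proof.
move=> c1; apply: (@integral_odd _ _ _ mu _ (fun v => 1 - v)) => //.
- exact: lebesgue_unit.
- exact: lebesgue_reflect.
- by apply/seteqP; split=> v /=; rewrite !in_itv/=; lra.
- by apply: measurable_funM => //; exact: measurable_vertex_score.
- by move=> v _; rewrite /vertex_score; ring.
Qed.

Lemma integral_score_sq :
  (\int[mu]_(v in `[0%R, 1%R]) (vertex_score v ^+ 2)%:E = 1)%E.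
Proof.
pose F (v : R) : R := (2 * v - 1) ^+ 3 / 2.
have dF (v : R) : is_derive v 1 F (vertex_score v ^+ 2).
  apply: is_derive_eq; rewrite /vertex_score exprMn sqr_sqrtr//.
  by rewrite /GRing.scale/=; field.
have cF (v : R) : {for v, continuous F}.
  by apply: differentiable_continuous; apply/derivable1_diffP; exact: ex_derive.
rewrite (@continuous_FTC2 _ _ F)//.
- by rewrite -EFinB; congr EFin; rewrite /F; field.
- apply: continuous_subspaceT => v.
  apply: differentiable_continuous; apply/derivable1_diffP.
  by rewrite /vertex_score; exact: ex_derive.
- split=> [v _||].
  + exact: ex_derive.
  + by apply: cvg_at_right_filter; exact: cF.
  + by apply: cvg_at_left_filter; exact: cF.
- by move=> v _; rewrite derive1E; apply: derive_val.
Qed.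

End score_integrals.

Section density_integrals.
Variables (R : realType) (d : nat).
Local Notation mu := (@lebesgue_measure R).
Local Notation T := (torus R d).
Implicit Types (m : 'cV[int]_d) (p : phase R) (x : T) (b v : R).

Lemma integral_cond_density_score b p m x : admissible b m ->
  (\int[mu]_(v in `[0%R, 1%R]) (cond_density b p m v x)%:E = 1)%E.
Proof.
move=> bm; rewrite -[RHS](@integral_score_density _ (b * Defs.harmonic m p x)).
  by apply: eq_integral => v _; rewrite /cond_density mulrAC.
by move=> v v01; rewrite mulrAC score_bound.
Qed.

Lemma integral_cond_density_position b p m v : admissible b m -> v \in `[0, 1] ->
  (\int[@haar R d]_x (cond_density b p m v x)%:E = 1)%E.
Proof.
move=> bm v01; apply: integral_harmonic_density; first by case: bm.
exact: (score_sqrt2_bound bm v01).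
Qed.

Lemma psiE b p m : m != 0 -> psi b p m = (b ^+ 2)%:E.
Proof.
move=> m0; rewrite /psi.
under eq_integral => v _.
  rewrite (eq_integral (fun x => ((b * vertex_score v) ^+ 2)%:E *
    (Defs.harmonic m p x ^+ 2)%:E)%E); last first.
    by move=> x _; rewrite -EFinM; congr EFin; rewrite /cond_density; ring.
  rewrite ge0_integralZl//; last 3 first.
  - apply/measurable_EFinP; apply: measurable_funX; exact: measurable_harmonic.
  - by move=> x _; rewrite lee_fin sqr_ge0.
  - by rewrite lee_fin sqr_ge0.
  rewrite integral_harmonic_sq// mule1 exprMn EFinM.
  over.
rewrite ge0_integralZl//; last 3 first.
- apply/measurable_EFinP; apply: measurable_funX; exact: measurable_vertex_score.
- by move=> x _; rewrite lee_fin sqr_ge0.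
- by rewrite lee_fin sqr_ge0.
by rewrite integral_score_sq mule1.
Qed.

End density_integrals.

(** * Invariance of the adjacency law *)

Section latent_variables.
Variables (R : realType) (d n : nat).
Local Notation T := (torus R d).
Local Notation L := (T * measurableTypeR R)%type.
Local Notation latents := (n.-tuple L).
Local Notation mun := (product_tuple (@latent_ref R d) n).
Implicit Types (m : 'cV[int]_d) (p : phase R) (b : R) (z : latents).

Lemma measurable_position i : measurable_fun setT (fun z : latents => position z i).
Proof. exact: measurableT_comp measurable_fst (measurable_tnth i). Qed.

Lemma measurable_score i : measurable_fun setT (fun z : latents => score z i).
Proof. exact: measurableT_comp measurable_snd (measurable_tnth i). Qed.

Lemma measurable_latent_space : measurable (@latent_space R d n).
Proof.
rewrite (_ : @latent_space R d n = \bigcap_(i in [set: 'I_n])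
    ((fun z : latents => score z i) @^-1` `[0, 1]%classic)); last first.
  by apply/seteqP; split=> z /= h i; [move=> _|]; exact: (h i).
apply: fin_bigcap_measurable => // i _.
exact: (measurable_preimage (measurable_score i)).
Qed.

Lemma measurable_latent_density b p m :
  measurable_fun setT (@latent_density R d n b p m).
Proof.
apply: measurable_prod => i _.
exact: measurableT_comp (measurable_cond_density b p m) (measurable_tnth i).
Qed.

Lemma latent_density_ge0 b p m z : admissible b m -> latent_space z ->
  0 <= latent_density b p m z.
Proof. by move=> bm z01; apply: prodr_ge0 => i _; exact: cond_density_ge0. Qed.

Variables (lambda eps : R) (k : 'cV[R]_d -> R) (omega : R -> R).
Hypotheses (lambda0 : 0 < lambda) (eps0 : 0 < eps).
Hypotheses (mk : measurable_fun setT k) (k0 : forall u, 0 <= k u).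
Hypotheses (momega : measurable_fun (`[0, 1] : set R) omega).
Hypothesis omega0 : forall v, v \in `[0, 1] -> 0 <= omega v.

Lemma measurable_omega_score i :
  measurable_fun (@latent_space R d n) (fun z => omega (score z i)).
Proof.
apply: (@measurable_comp _ _ _ _ _ _ (`[0, 1] : set R) omega) => //.
  by move=> _ [z z01 <-]; exact: z01.
exact: measurable_funS (measurable_score i).
Qed.

Lemma measurable_kernel_delta i j : measurable_fun setT
  (fun z : latents => k (eps^-1 *: torus_delta (position z i) (position z j))).
Proof.
apply: (measurableT_comp mk); apply: measurable_cV => l.
under eq_fun do rewrite mxE.
apply: measurable_funM => //; apply: (measurableT_comp (measurable_coord l)).
apply: (measurableT_comp (@measurable_torus_delta R d)
  (g := fun z => (position z i, position z j))).
apply: measurable_fun_pair; exact: measurable_position.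
Qed.

Lemma measurable_edge_prob i j : measurable_fun (@latent_space R d n)
  (fun z => edge_prob lambda eps k omega z i j).
Proof.
apply: measurable_funB => //; apply: measurableT_comp => //.
apply: measurable_funN; apply: measurable_funM.
  by apply: measurable_funM => //; apply: measurable_funM;
    exact: measurable_omega_score.
exact: measurable_funS (measurable_kernel_delta i j).
Qed.

Lemma edge_prob_itv z i j : latent_space z ->
  0 <= edge_prob lambda eps k omega z i j <= 1.
Proof.
move=> z01; rewrite /edge_prob subr_ge0 lerBlDr lerDl expR_ge0 andbT.
rewrite -expR0 ler_expR oppr_le0; apply: mulr_ge0 => //.
apply: mulr_ge0; last by apply: mulr_ge0; apply: omega0; exact: z01.
by rewrite divr_ge0 ?mulr_ge0 ?ler0n ?exprn_ge0// ltW.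
Qed.

Lemma adjacency_pmf_ge0 z a : latent_space z ->
  0 <= adjacency_pmf lambda eps k omega z a.
Proof.
move=> z01; rewrite /adjacency_pmf; case: ifP => // _.
apply: prodr_ge0 => i _; apply: prodr_ge0 => j _.
by apply: bernoulli_pmf_ge0; exact: edge_prob_itv.
Qed.

Lemma measurable_adjacency_pmf a : measurable_fun (@latent_space R d n)
  (fun z => adjacency_pmf lambda eps k omega z a).
Proof.
rewrite /adjacency_pmf; case: ((a^T == a) && _); last exact: measurable_cst.
apply: measurable_prod => i _; under eq_fun do rewrite big_mkcond/=.
apply: measurable_prod => j _; case: (i < j)%N; last exact: measurable_cst.
rewrite /bernoulli_pmf; case: (a i j); first exact: measurable_edge_prob.
by apply: measurable_funB => //; exact: measurable_edge_prob.
Qed.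

Lemma measurable_adjacency_integrand b p m (S : set 'M[bool]_n) :
  measurable_fun (@latent_space R d n) (fun z =>
    (latent_density b p m z *
     \sum_(a in S) adjacency_pmf lambda eps k omega z a)%:E).
Proof.
apply/measurable_EFinP; apply: measurable_funM.
  exact: measurable_funS (measurable_latent_density b p m).
rewrite (_ : (fun _ => _) = fun z => \sum_a
    (if a \in S then adjacency_pmf lambda eps k omega z a else 0)); last first.
  by apply/funext => z; rewrite big_mkcond.
apply: measurable_sum => a; case: (a \in S); last exact: measurable_cst.
exact: measurable_adjacency_pmf.
Qed.

Definition latent_affine (Q : 'M[int]_d) u z : latents :=
  [tuple (torus_affine Q u (tnth z i).1, (tnth z i).2) | i < n].

Lemma latent_affine_preserving Q u : orthZ Q ->
  measure_preserving mun mun (latent_affine Q u).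
Proof.
move=> QO; apply: (@measure_preserving_tuple _ _ _ _
  (fun q : L => (torus_affine Q u q.1, q.2))).
apply: (@measure_preserving_prod _ _ _ _ _ _ _ _ _ (@haar R d)
  (@lebesgue_measure R) (@haar R d) (@lebesgue_measure R) _ id).
  exact: haar_affine.
by split=> //; exact: measurable_id.
Qed.

(** For i < j, freezing vertex i leaves a null event on the position of vertex j;
its score ranges over a space of infinite measure, which does no harm as the
product of 0 and +oo is 0. *)
Lemma kernel_delta_negligible Q u (i j : 'I_n) : kernel_sym k Q -> (i < j)%N ->
  mun.-negligible [set z |
    k (eps^-1 *: torus_delta (torus_affine Q u (position z i))
                             (torus_affine Q u (position z j))) <>
    k (eps^-1 *: torus_delta (position z i) (position z j))].
Proof.
move=> kQ ij; have QO : orthZ Q by case: kQ.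
pose f (q : T * T) := k (eps^-1 *: torus_delta q.1 q.2).
have mf : measurable_fun setT f.
  apply: (measurableT_comp mk); apply: measurable_cV => l.
  under eq_fun do rewrite mxE.
  apply: measurable_funM => //; apply: (measurableT_comp (measurable_coord l)).
  exact: measurable_torus_delta.
have [mg _] := haar_affine u QO.
pose P (q : L * L) := f (torus_affine Q u q.1.1, torus_affine Q u q.2.1) ==
  f (q.1.1, q.2.1).
have mP : measurable_fun setT P.
  apply: measurable_fun_eqr; apply: (measurableT_comp mf);
    apply: measurable_fun_pair.
  - by apply: (measurableT_comp mg); exact: measurableT_comp.
  - by apply: (measurableT_comp mg); exact: measurableT_comp.
  - exact: measurableT_comp.
  - exact: measurableT_comp.
have mB : measurable (P @^-1` [set false]) by exact: (measurable_preimage mP).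
exists [set z | (P @^-1` [set false]) (tnth z i, tnth z j)]; split.
- apply: (measurable_preimage (f := fun z : latents => (tnth z i, tnth z j))) mB.
  by apply: measurable_fun_pair; exact: measurable_tnth.
- apply: product_tuple_null2 => // q.
  have [N [mN N0 kN]] := kernel_sym_delta u q.1 eps0 kQ.
  apply: (@subset_measure0 _ _ _ (@latent_ref R d) _ (N `*` setT)).
  + exact: measurable_xsection.
  + exact: measurableX.
  + move=> q'; rewrite /xsection/= inE /P/= => /eqP/eqP kq; split=> //.
    by apply: kN => /=; apply/eqP.
  + rewrite -[LHS]/((@haar R d \x @lebesgue_measure R)%E _).
    by rewrite product_measure1E// [X in (X * _)%E]N0 mul0e.
- by move=> z /= /eqP/negPf; rewrite /P/f.
Qed.

Lemma adjacency_pmf_edges z z' a :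
  (forall i j : 'I_n, (i < j)%N ->
    edge_prob lambda eps k omega z i j = edge_prob lambda eps k omega z' i j) ->
  adjacency_pmf lambda eps k omega z a = adjacency_pmf lambda eps k omega z' a.
Proof.
move=> zz'; rewrite /adjacency_pmf; case: ((a^T == a) && _) => //.
by apply: eq_bigr => i _; apply: eq_bigr => j ij; rewrite zz'.
Qed.

Lemma latent_density_affine b p m Q u z : orthZ Q ->
  latent_density b (phase_shift p (Q *m m) u) (Q *m m) (latent_affine Q u z) =
  latent_density b p m z.
Proof.
move=> QO; apply: eq_bigr => i _.
by rewrite /cond_density /position /score tnth_mktuple harmonic_affine.
Qed.

(** Change of variables along the affine map at every vertex: the density is
exactly transported, and the weight of each matrix is unchanged off the union of
finitely many null sets, one for each edge. *)
Lemma adjacency_law_affine b p m Q u : admissible b m -> kernel_sym k Q ->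
  admissible b (Q *m m) ->
  adjacency_law (n := n) lambda eps k omega b p m =
  adjacency_law lambda eps k omega b (phase_shift p (Q *m m) u) (Q *m m).
Proof.
move=> bm kQ bQm; have QO : orthZ Q by case: kQ.
apply/funext => S; rewrite /adjacency_law.
set mg := Q *m m; set pg := phase_shift p mg u.
set D := @latent_space R d n; pose G := latent_affine Q u.
pose F b' p' m' z := (latent_density b' p' m' z *
     \sum_(a in S) adjacency_pmf lambda eps k omega z a)%:E.
have GP : measure_preserving mun mun G by exact: latent_affine_preserving.
have mD : measurable D by exact: measurable_latent_space.
have positionG z i : position (G z) i = torus_affine Q u (position z i).
  by rewrite /position tnth_mktuple.
have scoreG z i : score (G z) i = score z i by rewrite /score tnth_mktuple.
have GD : G @^-1` D = D.
  by apply/seteqP; split=> z /= zD i; have := zD i; rewrite scoreG.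
have mF b' p' m' : measurable_fun D (F b' p' m').
  exact: measurable_adjacency_integrand.
rewrite -(measure_preserving_integral GP mD (mF b pg mg)); last first.
  move=> z zD; rewrite lee_fin mulr_ge0 ?latent_density_ge0//.
  by apply: sumr_ge0 => a _; exact: adjacency_pmf_ge0.
have GDD : G @` D `<=` D.
  by move=> _ [z zD <-]; suff: (G @^-1` D) z by []; rewrite GD.
have mG : measurable_fun D G by exact: measurable_funS GP.1.
have mFG : measurable_fun D (F b pg mg \o G).
  exact: measurable_comp mD GDD (mF b pg mg) mG.
rewrite GD; apply: (ae_eq_integral _ _ mD (mF b p m) mFG).
have : mun.-negligible [set z | exists ij : 'I_n * 'I_n, (ij.1 < ij.2)%N /\
    k (eps^-1 *: torus_delta (torus_affine Q u (position z ij.1))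
                             (torus_affine Q u (position z ij.2))) <>
    k (eps^-1 *: torus_delta (position z ij.1) (position z ij.2))].
  apply: negligible_exists => -[i j] /=.
  have [ij|ij] := boolP (i < j)%N; last first.
    by apply: negligibleS (@negligible_set0 _ _ _ mun) => z /= [].
  by apply: negligibleS (kernel_delta_negligible u kQ ij) => z [].
apply: negligibleS => z /= FG; apply: contrapT => noij; apply: FG => zD.
have GS : \sum_(a in S) adjacency_pmf lambda eps k omega (G z) a =
    \sum_(a in S) adjacency_pmf lambda eps k omega z a.
  apply: eq_bigr => a _; apply: adjacency_pmf_edges => i j ij.
  rewrite /edge_prob !positionG !scoreG.
  have -> // : k (eps^-1 *: torus_delta (torus_affine Q u (position z i))
                                    (torus_affine Q u (position z j))) =
    k (eps^-1 *: torus_delta (position z i) (position z j)).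
  by apply: contrapT => kij; apply: noij; exists (i, j).
by rewrite /= /F GS (latent_density_affine b p m u z QO).
Qed.

End latent_variables.

(** * Marginals of the latent law *)

Lemma integral_setX d1 d2 (T1 : measurableType d1) (T2 : measurableType d2)
    (R : realType) (m1 : {sigma_finite_measure set T1 -> \bar R})
    (m2 : {sigma_finite_measure set T2 -> \bar R}) (D1 : set T1) (D2 : set T2)
    (f : T1 * T2 -> \bar R) :
  measurable D1 -> measurable D2 -> measurable_fun (D1 `*` D2) f ->
  (forall q, (D1 `*` D2) q -> (0 <= f q)%E) ->
  (\int[m1 \x m2]_(q in D1 `*` D2) f q =
   \int[m1]_(x in D1) \int[m2]_(y in D2) f (x, y))%E /\
  (\int[m1 \x m2]_(q in D1 `*` D2) f q =
   \int[m2]_(y in D2) \int[m1]_(x in D1) f (x, y))%E.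
Proof.
move=> mD1 mD2 mf f0.
have mD : measurable (D1 `*` D2) by exact: measurableX.
have mg : measurable_fun setT (f \_ (D1 `*` D2)).
  by apply/(measurable_restrict _ mD measurableT); rewrite setTI.
have g0 q : (0 <= (f \_ (D1 `*` D2)) q)%E by exact: erestrict_ge0.
rewrite integral_mkcond; split.
  rewrite fubini_tonelli1// [RHS]integral_mkcond; apply: eq_integral => x _.
  rewrite /fubini_F [in RHS]/patch; case: ifPn => xD1; last first.
    apply: integral0_eq => y _; rewrite patchE memNset//= => -[xD _].
    by move/negP: xD1; apply; rewrite inE.
  rewrite [RHS]integral_mkcond; apply: eq_integral => y _.
  rewrite !patchE; congr (if _ then _ else _).
  by apply/idP/idP; rewrite !inE => yD; [case: yD|split=> //; exact: set_mem].
rewrite fubini_tonelli2// [RHS]integral_mkcond; apply: eq_integral => y _.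
rewrite /fubini_G [in RHS]/patch; case: ifPn => yD2; last first.
  apply: integral0_eq => x _; rewrite patchE memNset//= => -[_ yD].
  by move/negP: yD2; apply; rewrite inE.
rewrite [RHS]integral_mkcond; apply: eq_integral => x _.
rewrite !patchE; congr (if _ then _ else _).
by apply/idP/idP; rewrite !inE => xD; [case: xD|split=> //; exact: set_mem].
Qed.

Section latent_marginals.
Variables (R : realType) (d n : nat).
Local Notation T := (torus R d).
Local Notation L := (T * measurableTypeR R)%type.
Local Notation latents := (n.-tuple L).
Local Notation mun := (product_tuple (@latent_ref R d) n).
Local Notation mu := (@lebesgue_measure R).
Local Notation unit_scores := (`[0, 1]%classic : set (measurableTypeR R)).
Implicit Types (m : 'cV[int]_d) (p : phase R) (b : R).

(** The density is a product, so the integral over a product event factors into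
integrals over single vertices. *)
Lemma latent_law_box b p m (C : 'I_n -> set L) : admissible b m ->
  (forall i, measurable (C i)) ->
  (latent_law b p m [set z : latents | forall i, C i (tnth z i)] =
   \prod_i \int[@latent_ref R d]_(q in C i `&` (setT `*` unit_scores))
     (cond_density b p m q.2 q.1)%:E)%E.
Proof.
move=> bm mC; pose D i := C i `&` (setT `*` unit_scores).
have mD i : measurable (D i) by apply: measurableI => //; exact: measurableX.
pose f i (q : L) : R := ((fun q : L => cond_density b p m q.2 q.1) \_ (D i)) q.
have mf i : measurable_fun setT (f i).
  apply/(measurable_restrict _ (mD i) measurableT).
  exact: measurable_funS (measurable_cond_density b p m).
have f0 i q : 0 <= f i q.
  rewrite /f patchE; case: ifPn => //; rewrite inE => -[_ [_ q01]].
  exact: cond_density_ge0.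
transitivity (\prod_i \int[@latent_ref R d]_q (f i q)%:E)%E; last first.
  apply: eq_bigr => i _; rewrite [RHS]integral_mkcond; apply: eq_integral => q _.
  by rewrite /f !patchE; case: ifP.
rewrite -integral_product_tuple// /latent_law integral_mkcond.
apply: eq_integral => z _; rewrite patchE; case: ifPn => zC.
  congr EFin; apply: eq_bigr => i _; rewrite /f patchE ifT// inE.
  by move: zC; rewrite inE => -[Cz z01]; split=> //; split=> //; exact: z01.
have [i zi] : exists i, ~ D i (tnth z i).
  apply: contrapT => /forallNP zD; move/negP: zC; apply; rewrite inE.
  by split=> i; have /contrapT[? []] := zD i.
by rewrite (bigD1 i)//= /f patchE memNset// mul0r.
Qed.

Lemma integral_latent_rectangle b p m (B : set T) (C : set R) :
  admissible b m -> measurable B -> measurable C ->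
  (\int[@latent_ref R d]_(q in B `*` (C `&` unit_scores))
     (cond_density b p m q.2 q.1)%:E =
   \int[@haar R d]_(x in B) \int[mu]_(v in C `&` unit_scores)
     (cond_density b p m v x)%:E)%E /\
  (\int[@latent_ref R d]_(q in B `*` (C `&` unit_scores))
     (cond_density b p m q.2 q.1)%:E =
   \int[mu]_(v in C `&` unit_scores) \int[@haar R d]_(x in B)
     (cond_density b p m v x)%:E)%E.
Proof.
move=> bm mB mC; apply: (@integral_setX _ _ _ _ _ (@haar R d) mu B
    (C `&` unit_scores) (fun q => (cond_density b p m q.2 q.1)%:E)) => //.
- exact: measurableI.
- apply/measurable_EFinP; exact: measurable_funS (measurable_cond_density b p m).
- by move=> q [_ [_ q01]]; rewrite lee_fin; exact: cond_density_ge0.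
Qed.

Lemma integral_latent_position b p m (B : set T) : admissible b m -> measurable B ->
  (\int[@latent_ref R d]_(q in (B `*` setT) `&` (setT `*` unit_scores))
     (cond_density b p m q.2 q.1)%:E = @haar R d B)%E.
Proof.
move=> bm mB; rewrite -setXI setIT.
have [-> _] := integral_latent_rectangle p bm mB (@measurableT _ (measurableTypeR R)).
under eq_integral => x _ do rewrite setTI integral_cond_density_score//.
by rewrite integral_cst// mul1e.
Qed.

Lemma integral_latent_score b p m (C : set R) : admissible b m -> measurable C ->
  (\int[@latent_ref R d]_(q in (setT `*` C) `&` (setT `*` unit_scores))
     (cond_density b p m q.2 q.1)%:E = uniform_prob (@ltr01 R) C)%E.
Proof.
move=> bm mC; rewrite -setXI setIT.
have [_ ->] := integral_latent_rectangle p bm measurableT mC.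
rewrite /uniform_prob integral_uniform_pdf; apply: eq_integral => v.
rewrite inE => -[_ v01]; rewrite integral_cond_density_position//.
by move: v01; rewrite /= in_itv/= /uniform_pdf => ->; rewrite subr0 invr1.
Qed.

Lemma latent_law_marginal b p m (B : set L) (i : 'I_n) :
  admissible b m -> measurable B ->
  (latent_law b p m [set z : latents | B (tnth z i)] =
   \int[@latent_ref R d]_(q in B `&` (setT `*` unit_scores))
     (cond_density b p m q.2 q.1)%:E)%E.
Proof.
move=> bm mB; pose C j : set L := if j == i then B else setT.
rewrite (_ : [set z | _] = [set z : latents | forall j, C j (tnth z j)]); last first.
  apply/seteqP; split=> z /=; last by move=> /(_ i); rewrite /C eqxx.
  by move=> Bz j; rewrite /C; case: eqP => [->|].
rewrite latent_law_box//; last by move=> j; rewrite /C; case: ifP.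
rewrite (bigD1 i)//= {1}/C eqxx big1 ?mule1// => j ji.
rewrite /C (negbTE ji) -setXTT integral_latent_position//.
exact: probability_setT.
Qed.

End latent_marginals.

(** * The transformations of the parameters *)

Section invariance.
Variables (R : realType) (d n : nat).
Variables (lambda eps : R) (k : 'cV[R]_d -> R) (omega : R -> R).
Hypotheses (lambda0 : 0 < lambda) (eps0 : 0 < eps).
Hypotheses (mk : measurable_fun setT k) (k0 : forall u, 0 <= k u).
Hypotheses (momega : measurable_fun (`[0, 1] : set R) omega).
Hypothesis omega0 : forall v, v \in `[0, 1] -> 0 <= omega v.
Local Notation P := (@adjacency_law R d n lambda eps k omega).
Implicit Types (b : R) (p : phase R) (m : 'cV[int]_d).

Lemma admissible_act b m (Q : 'M[int]_d) : orthZ Q -> admissible b m ->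
  admissible b (Q *m m).
Proof.
move=> QO [m0 b6]; split=> //; apply: contra m0 => /eqP Qm0.
by rewrite -[m]mul1mx -QO -mulmxA Qm0 mulmx0.
Qed.

Lemma admissible_opp b m : admissible b m -> admissible (- b) m.
Proof. by move=> [m0 b6]; split; rewrite ?normrN. Qed.

Lemma adjacency_law_opp b p m : P (- b) (p + phase_class pi) m = P b p m.
Proof.
apply/funext => S; rewrite /adjacency_law; apply: eq_integral => z _.
have -> // : latent_density (- b) (p + phase_class pi) m z =
  latent_density b p m z.
by apply: eq_bigr => i _; rewrite cond_density_opp.
Qed.

Lemma adjacency_law_sym b p m Q u : admissible b m -> kernel_sym k Q ->
  P b p m = P b (phase_shift p (Q *m m) u) (Q *m m).
Proof.
move=> bm kQ; apply: adjacency_law_affine => //.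
by apply: admissible_act => //; case: kQ.
Qed.

Lemma adjacency_law_phase b p p' m : admissible b m -> P b p m = P b p' m.
Proof.
move=> bm; have [m0 _] := bm; have [u <-] := phase_shift_surj p p' m0.
by rewrite {1}(adjacency_law_sym p u bm (kernel_sym1 k)) mul1mx.
Qed.

Lemma adjacency_law_phase_opp b p p' m : admissible b m ->
  P b p m = P (- b) p' m.
Proof.
move=> bm; rewrite -adjacency_law_opp; apply: adjacency_law_phase.
exact: admissible_opp.
Qed.

End invariance.

Lemma phase_class_pi_neq0 (R : realType) : phase_class (pi : R) != phase_class 0.
Proof.
rewrite phase_class_eq subr0 unfold_in /two_pi_multiples.
rewrite invfM mulrCA mulfV ?gt_eqF ?pi_gt0// mulr1.
apply/negP => /intrP[z z2].
have z0 : 0 < z by rewrite -(ltr0z R) -z2 invr_gt0.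
have z1 : z < 1 by rewrite -(ltrz1 R) -z2 invf_lt1// ltr1n.
by move: z1; rewrite ltNge -gtz0_ge1 z0.
Qed.

Theorem propositionS1p1 (R : realType) (d : nat) (lambda : R) (eps : nat -> R)
    (k : 'cV[R]_d -> R) (omega : R -> R) :
  (1 <= d)%N -> 0 < lambda -> (forall n, 0 < eps n) ->
  measurable_fun setT k -> (forall u, 0 <= k u) ->
  (forall u, k (- u) = k u) ->
  measurable_fun (`[0, 1] : set R) omega -> (forall v, v \in `[0, 1] -> 0 <= omega v) ->
  let P n := @adjacency_law R d n lambda (eps n) k omega in
  (* conditional densities and marginals of the latent variables *)
  (forall (b : R) (p : phase R) (m : 'cV[int]_d), admissible b m ->
    (forall x : torus R d,
      [/\ measurable_fun (`[0, 1] : set R) (fun v => cond_density b p m v x),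
          forall v, v \in `[0, 1] -> 0 <= cond_density b p m v x &
          (\int[@lebesgue_measure R]_(v in `[0%R, 1%R])
             (cond_density b p m v x)%:E = 1)%E]) /\
    (forall n (i : 'I_n),
      (forall B, measurable B ->
         latent_law b p m [set z | B (position z i)] = haar B) /\
      (forall B : set R, measurable B ->
         latent_law b p m [set z | B (score z i)] =
         uniform_prob (@ltr01 R) B))) /\
  (* symmetry under the kernel stabilizer and translations *)
  (forall (b : R) (p : phase R) (m : 'cV[int]_d) (Q : 'M[int]_d)
      (tau : torus R d), admissible b m -> kernel_sym k Q ->
    (forall u u' : 'cV[R]_d, torus_class u = tau -> torus_class u' = tau ->
       phase_shift p (Q *m m) u = phase_shift p (Q *m m) u') /\
    (forall u : 'cV[R]_d, torus_class u = tau ->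
       let mg := Q *m m in
       let pg := phase_shift p mg u in
       forall n, (2 <= n)%N ->
         P n b p m = P n b pg mg /\
         P n b p m = P n (- b) (pg + phase_class pi) mg)) /\
  (* the phase and the sign of the amplitude are irrelevant, hence no
     function of the adjacency law recovers them *)
  (forall (b : R) (p p' : phase R) (m : 'cV[int]_d) n,
    admissible b m -> (2 <= n)%N ->
    P n b p m = P n b p' m /\ P n b p m = P n (- b) p' m) /\
  (forall (b : R) (m : 'cV[int]_d) n, admissible b m -> (2 <= n)%N ->
    ~ exists f : (set 'M[bool]_n -> \bar R) -> phase R,
        forall p, f (P n b p m) = p) /\
  (forall (b : R) (p : phase R) (m : 'cV[int]_d) n,
    admissible b m -> b != 0 -> (2 <= n)%N ->
    ~ exists s : (set 'M[bool]_n -> \bar R) -> R,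
        s (P n b p m) = Num.sg b /\ s (P n (- b) p m) = Num.sg (- b)) /\
  (* the kernel stabilizer is a subgroup of O(d, Z) *)
  [/\ kernel_sym k `<=` @orthZ d,
      kernel_sym k 1%:M,
      forall Q Q', kernel_sym k Q -> kernel_sym k Q' -> kernel_sym k (Q *m Q') &
      forall Q, kernel_sym k Q -> kernel_sym k (invmx Q)] /\
  (* frequency orbits *)
  (forall (b : R) (p : phase R) (m m' : 'cV[int]_d) (u : 'cV[R]_d) n,
    admissible b m -> kernel_orbit k m m' -> (2 <= n)%N ->
    P n b p m = P n b (phase_shift p m' u) m') /\
  kernel_sym k (- 1%:M) /\
  (forall m m' : 'cV[int]_d, m != 0 ->
    kernel_orbit k m m' -> kernel_orbit k m (- m')) /\
  (* zero amplitude *)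
  (forall (p : phase R) (m : 'cV[int]_d) (x : torus R d) (v : R),
    m != 0 -> v \in `[0, 1] -> cond_density 0 p m v x = 1) /\
  (forall (p p' : phase R) (m m' : 'cV[int]_d) n, m != 0 -> m' != 0 ->
    @latent_law R d n 0 p m = latent_law 0 p' m' /\
    P n 0 p m = P n 0 p' m') /\
  (* the functional psi *)
  (forall (b : R) (p : phase R) (m : 'cV[int]_d), admissible b m ->
    psi b p m = (b ^+ 2)%:E) /\
  (forall (b : R) (p p' : phase R) (m : 'cV[int]_d) (Q : 'M[int]_d)
      (u : 'cV[R]_d), admissible b m -> kernel_sym k Q ->
    let mg := Q *m m in
    let pg := phase_shift p mg u in
    [/\ psi b pg mg = psi b p m,
        psi (- b) (pg + phase_class pi) mg = psi b p m,
        psi b p' m = psi b p m &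
        psi (- b) p' m = psi b p m]).
Proof.
move=> d1 lambda0 eps0 mk k0 kN momega omega0 P.
split; [|split; [|split; [|split; [|split; [|split]]]]];
  last split; last split; last split; last split; last split; last split.
- move=> b p m bm; split.
    move=> x; split.
    + apply: measurable_funD => //; apply: measurable_funM => //.
      by apply: measurable_funM => //; exact: measurable_vertex_score.
    + by move=> v; exact: cond_density_ge0.
    + exact: integral_cond_density_score.
  move=> n i; split=> B mB.
    rewrite -(integral_latent_position p bm mB).
    rewrite -(latent_law_marginal p i bm); last exact: measurableX.
    by congr latent_law; apply/seteqP; split=> z //= [].
  rewrite -(integral_latent_score p bm mB).
  rewrite -(latent_law_marginal p i bm); last exact: measurableX.
  by congr latent_law; apply/seteqP; split=> z //= [].
- move=> b p m Q tau bm kQ; split.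
    by move=> u u' <- /esym; exact: phase_shift_lift.
  move=> u _ mg pg n _; split; first exact: adjacency_law_sym.
  rewrite /P adjacency_law_opp; exact: adjacency_law_sym.
- move=> b p p' m n bm _; split; first exact: adjacency_law_phase.
  exact: adjacency_law_phase_opp.
- move=> b m n bm _ [f fP].
  have /eqP := phase_class_pi_neq0 R; apply.
  rewrite -[LHS]fP -[RHS]fP; congr f; exact: adjacency_law_phase.
- move=> b p m n bm b0 _ [s [sb sNb]].
  have bb : Num.sg b = Num.sg (- b).
    by rewrite -sb -sNb; congr s; exact: adjacency_law_phase_opp.
  have : Num.sg b != 0 by rewrite sgr_eq0.
  by move: bb; rewrite sgrN => bb /eqP; apply; lra.
- split.
  + by move=> Q [].
  + exact: kernel_sym1.
  + exact: kernel_symM.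
  + exact: kernel_symV.
- move=> b p m _ u n bm [Q kQ <-] _; exact: adjacency_law_sym.
- exact: kernel_symN1.
- move=> m _ _ [Q kQ <-]; exists (- 1%:M *m Q).
    by apply: kernel_symM => //; exact: kernel_symN1.
  by rewrite -mulmxA mulNmx mul1mx.
- by move=> p m x v _ _; rewrite /cond_density !mul0r addr0.
- move=> p p' m m' n _ _.
  have E q l z : @latent_density R d n 0 q l z = 1.
    by apply: big1 => i _; rewrite /cond_density !mul0r addr0.
  by split; apply/funext => S; [rewrite /latent_law|rewrite /P /adjacency_law];
    apply: eq_integral => z _; rewrite !E.
- by move=> b p m [m0 _]; exact: psiE.
- move=> b p p' m Q u bm kQ mg pg.
  have [m0 _] := bm; have [mg0 _] := admissible_act (proj1 kQ) bm.
  by split; rewrite !psiE// sqrrN.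
Qed.
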